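(* Assume that $\mathbf{E}\ln\rho_0<0$, that there exists a unique $\kappa>0$ such that $\mathbf{E}[\rho_0^{\kappa}]=1$ and $\mathbf{E}[\rho_0^{\kappa}\ln^+\rho_0]<\infty$, and that the distribution of $\ln\rho_0$ under $\mathbf{P}$ is non-lattice. Assume moreover $\kappa<1$. Then for $\mathbf{P}$-almost every environment $\omega$ the sequence of lazy random walks in random environment $(Y^n_k)_{k\in\mathbb{N}_0}$ on $\{0,\dots,n\}$, $n\in\mathbb{N}$, does not exhibit a cutoff; that is, there are no sequences $(t_n)_{n\in\mathbb{N}}$ and $(f_n)_{n\in\mathbb{N}}$ such that it exhibits a cutoff with cutoff times $(t_n)$ and window size $(f_n)$.
   Context: Environment: $\omega=(\omega_k)_{k\in\mathbb{Z}}$ is a family of i.i.d. random variables with values in $(0,1)$; $\mathbf{P}$ is its law, $\mathbf{E}$ the corresponding expectation, and $\rho_i:=(1-\omega_i)/\omega_i$. Lazy reflected walk: for $n\in\mathbb{N}$ put $\omega^n_0:=1$, $\omega^n_k:=\omega_k$ for $1\le k\le n-1$, $\omega^n_n:=0$. Under $P_{\omega^n}^z$, $(Y^n_k)_{k\in\mathbb{N}_0}$ is the Markov chain on $\{0,\dots,n\}$ started at $z$ which from $i$ jumps to $i+1$ with probability $\omega^n_i/2$, stays at $i$ with probability $1/2$, and jumps to $i-1$ with probability $(1-\omega^n_i)/2$. Cutoff: for a sequence of aperiodic irreducible Markov chains $(U^n_k)_{k\in\mathbb{N}_0}$ on finite state spaces $\Omega_n$ with $|\Omega_n|\to\infty$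 and stationary distributions $\pi_n$, let $d_n(l):=\max_{x\in\Omega_n}\|\mathbb{P}^x(U^n_l\in\cdot)-\pi_n\|_{TV}$ (total variation distance, chain started at $x$). The sequence exhibits a cutoff with cutoff times $(t_n)$ and window size $(f_n)$ if (1) $f_n=o(t_n)$; (2) $\lim_{c\to\infty}\liminf_{n\to\infty}d_n(t_n-cf_n)=1$; (3) $\lim_{c\to\infty}\limsup_{n\to\infty}d_n(t_n+cf_n)=0$. Integer parts are omitted, i.e. $d_n(t)$ means $d_n(\lfloor t\rfloor)$ for real $t\ge 0$. *)

(* Defs.v *)
From HB Require Import structures.
From mathcomp Require Import all_boot all_order all_algebra.
From mathcomp Require Import finmap.
From mathcomp Require Import all_classical all_reals all_analysis.
From mathcomp Require Import ring.

Set Implicit Arguments.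
Unset Strict Implicit.
Unset Printing Implicit Defensive.

Import Order.TTheory GRing.Theory Num.Theory.
Import numFieldNormedType.Exports.

Local Open Scope classical_set_scope.
Local Open Scope ring_scope.

Section IID.
Context d (T : measurableType d) (R : realType) (P : probability T R).

Definition mutually_independent (I : choiceType) (X : I -> {RV P >-> R}) : Prop :=
  forall (J : {fset I}) (A : I -> set R), (forall j, measurable (A j)) ->
    P (\bigcap_(j in [set` J]) (X j @^-1` A j)) =
    (\prod_(j <- J) P (X j @^-1` A j))%E.

Definition identically_distributed (I : Type) (X : I -> {RV P >-> R}) : Prop :=
  forall i j (A : set R), measurable A ->
    distribution P (X i) A = distribution P (X j) A.

(* Lattice in the sense of renewal theory (also called arithmetic): carried by
   hZ for some h > 0.  A law that is not carried by any translate a + hZ is in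
   particular nonlattice in this sense. *)
Definition lattice (X : T -> R) : Prop :=
  exists h : R, 0 < h /\ P (X @^-1` range (fun z : int => z%:~R * h)) = 1%E.

Definition nonlattice (X : T -> R) : Prop := ~ lattice X.

End IID.

Definition rho (R : realType) (w : R) : R := (1 - w) / w.

Definition lnp (R : realType) (y : R) : R := Num.max (ln y) 0.

Section FiniteMarkovChains.
Context (R : realType) (S : finType).
Implicit Types (p : S -> S -> R) (mu nu pi : S -> R).

Definition is_distr mu : Prop := (forall x, 0 <= mu x) /\ \sum_x mu x = 1.

Definition stochastic p : Prop := forall x, is_distr (p x).

(* chain_law p x l y is the probability that the chain with transition
   probabilities p started at x is at y at time l. *)
Fixpoint chain_law p (x : S) (l : nat) (y : S) : R :=
  if l is l'.+1 then \sum_z chain_law p x l' z * p z y else (y == x)%:R.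

Definition irreducible p : Prop :=
  forall x y, exists l, 0 < chain_law p x l y.

Definition aperiodic p : Prop :=
  forall x (m : nat),
    (forall l, (0 < l)%N -> 0 < chain_law p x l x -> (m %| l)%N) -> m = 1%N.

Definition stationary p pi : Prop :=
  is_distr pi /\ forall y, \sum_x pi x * p x y = pi y.

Definition tv_dist mu nu : R :=
  \big[Num.max/0]_(A : {set S}) `|\sum_(x in A) mu x - \sum_(x in A) nu x|.

Definition dist_to_stat p pi (l : nat) : R :=
  \big[Num.max/0]_(x : S) tv_dist (chain_law p x l) pi.

End FiniteMarkovChains.

(* Real times are rounded down by Num.truncn, which is the integer part on
   nonnegative reals and 0 on negative ones. *)
Definition exhibits_cutoff (R : realType) (S : nat -> finType)
    (p : forall n, S n -> S n -> R) (pi : forall n, S n -> R)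
    (t f : nat -> R) : Prop :=
  let d n (s : R) := dist_to_stat (p n) (pi n) (Num.truncn s) in
  [/\ f =o_\oo t,
      limn_inf (fun n => d n (t n - c * f n)) @[c --> +oo] --> (1 : R) &
      limn_sup (fun n => d n (t n + c * f n)) @[c --> +oo] --> (0 : R)].

Section LazyReflectedWalk.
Context (R : realType).
Implicit Types (w : int -> R) (n : nat).

Definition reflected_env w n (k : nat) : R :=
  if k == 0%N then 1 else if k == n then 0 else w k%:Z.

(* The state space {0,...,n} is 'I_n.+1; only n >= 1 is meaningful, since the
   two boundary conditions conflict for n = 0. *)
Definition lazy_walk w n (i j : 'I_n.+1) : R :=
  if val j == i.+1 then reflected_env w n i / 2
  else if j == i then 2^-1
  else if val i == j.+1 then (1 - reflected_env w n i) / 2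
  else 0.

End LazyReflectedWalk.

(* The lazy reflected walk satisfies the standing assumptions under which
   cutoff is defined. *)
Section LazyWalkIsChain.
Context (R : realType).

Lemma chain_law_ge0 (S : finType) (p : S -> S -> R) :
  stochastic p -> forall x l y, 0 <= chain_law p x l y.
Proof.
move=> sp x; elim=> [|l IH] y /=; first exact: ler0n.
by apply: sumr_ge0 => z _; rewrite mulr_ge0 ?IH//; case: (sp z).
Qed.

Lemma chain_law_step (S : finType) (p : S -> S -> R) x z y l :
  stochastic p -> 0 < chain_law p x l z -> 0 < p z y ->
  0 < chain_law p x l.+1 y.
Proof.
move=> sp lz pzy /=; rewrite (bigD1 z)//= ltr_pwDl ?mulr_gt0//.
apply: sumr_ge0 => u _; rewrite mulr_ge0 ?chain_law_ge0//.
by case: (sp u).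
Qed.

Section Walk.
Variables (w : int -> R) (n : nat).
Hypotheses (w01 : forall k, 0 < w k < 1) (n0 : (0 < n)%N).

Local Notation e := (reflected_env w n).
Local Notation p := (@lazy_walk R w n).

Lemma reflected_env_gt0 k : (k < n)%N -> 0 < e k.
Proof.
move=> kn; rewrite /reflected_env; case: eqP => // _.
by rewrite ltn_eqF//; case/andP: (w01 k%:Z).
Qed.

Lemma reflected_env_lt1 k : (0 < k)%N -> e k < 1.
Proof.
move=> k0; rewrite /reflected_env gtn_eqF//; case: ifP => _//.
by case/andP: (w01 k%:Z).
Qed.

Lemma reflected_env_bounds k : 0 <= e k <= 1.
Proof.
rewrite /reflected_env; case: ifP => _; first by rewrite ler01 lexx.
by case: ifP => _; [rewrite lexx ler01|case/andP: (w01 k%:Z) => /ltW-> /ltW].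
Qed.

Lemma reflected_env0 : e 0 = 1. Proof. by []. Qed.

Lemma reflected_envn : e n = 0.
Proof. by rewrite /reflected_env gtn_eqF// eqxx. Qed.

Lemma lazy_walkE (i j : 'I_n.+1) :
  p i j = (val j == i.+1)%:R * (e i / 2) + (j == i)%:R * 2^-1
        + (val i == j.+1)%:R * ((1 - e i) / 2).
Proof.
rewrite /lazy_walk -(inj_eq val_inj) /=.
case: (eqVneq (val j) i.+1) => [E|_].
  by rewrite E (gtn_eqF (ltnSn i)) ltn_eqF// !mul0r !addr0 mul1r.
rewrite mul0r add0r; case: (eqVneq (val j) i) => [E|_].
  by rewrite E ltn_eqF// mul0r addr0 mul1r.
by rewrite mul0r add0r; case: ifP => _; rewrite ?mul1r ?mul0r.
Qed.

Lemma sum_pick (k : nat) (a : R) :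
  \sum_(j < n.+1) ((val j == k)%:R * a) = (k < n.+1)%:R * a.
Proof.
case: (ltnP k n.+1) => kn.
  rewrite (bigD1 (Ordinal kn))//= eqxx big1 ?addr0// => j jk.
  by move: jk; rewrite -(inj_eq val_inj)/= => /negbTE->; rewrite mul0r.
by rewrite big1 ?mul0r// => j _; rewrite ltn_eqF ?mul0r// (leq_trans (ltn_ord j)).
Qed.

Lemma lazy_walk_stochastic : stochastic p.
Proof.
move=> i; have /andP[e0 e1] := reflected_env_bounds i; split=> [j|].
  by rewrite lazy_walkE !addr_ge0// mulr_ge0// divr_ge0// subr_ge0.
under eq_bigr do rewrite lazy_walkE -(inj_eq val_inj).
rewrite !big_split/= !sum_pick// ltn_ord ltnS.
have -> : \sum_(j < n.+1) (val i == j.+1)%:R * ((1 - e i) / 2) =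
          (1 - e i) / 2.
  case: (posnP i) => [i0|i0].
    rewrite i0 reflected_env0 subrr mul0r big1// => j _.
    by rewrite mulr0.
  under eq_bigr do rewrite -[X in X == _](prednK i0) eqSS eq_sym.
  rewrite sum_pick// mulr_natl (leq_ltn_trans (leq_pred _) (ltn_ord i)).
  by rewrite mulr1n.
case: (ltnP i n) => ni; first by rewrite !mul1r; field.
have -> : val i = n by apply/eqP; rewrite eqn_leq ni -ltnS ltn_ord.
by rewrite reflected_envn !mul1r !mul0r; field.
Qed.

Lemma lazy_walk_irreducible : irreducible p.
Proof.
move=> x y.
have up : forall k, (x <= k < n.+1)%N -> exists l, 0 < chain_law p x l (inord k).
  elim=> [|k IH] /andP[xk kn].
    exists 0%N => /=; have -> : x = inord 0; last by rewrite eqxx ltr01.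
    by apply: val_inj; rewrite /= inordK//; move: xk; rewrite leqn0 => /eqP.
  case: (ltngtP x k.+1) xk => // [xk|xk] _.
    have [|l hl] := IH; first by rewrite -ltnS xk ltnW.
    exists l.+1; apply: (chain_law_step lazy_walk_stochastic hl).
    rewrite /lazy_walk /= !inordK ?eqxx ?(ltnW kn)//.
    by rewrite divr_gt0// reflected_env_gt0.
  exists 0%N => /=; have -> : x = inord k.+1; last by rewrite eqxx ltr01.
  by apply: val_inj; rewrite /= inordK.
have dn : forall k, (k <= x)%N -> exists l, 0 < chain_law p x l (inord (x - k)).
  elim=> [|k IH] kx.
    by apply: up; rewrite subn0 leqnn ltn_ord.
  have [|l hl] := IH; first exact: ltnW.
  exists l.+1; apply: (chain_law_step lazy_walk_stochastic hl).
  have a1 : (x - k < n.+1)%N by rewrite (leq_ltn_trans (leq_subr _ _)).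
  have a2 : (x - k.+1 < n.+1)%N by rewrite (leq_ltn_trans (leq_subr _ _)).
  have a3 : (x - k = (x - k.+1).+1)%N by rewrite subnSK.
  rewrite lazy_walkE -(inj_eq val_inj) /= !inordK// a3 eqxx.
  rewrite (ltn_eqF (leqW (ltnSn _))) (ltn_eqF (ltnSn _)) !mul0r !add0r mul1r.
  by rewrite divr_gt0// subr_gt0 reflected_env_lt1.
rewrite -[y]inord_val; case: (leqP x y) => xy; first by apply: up; rewrite xy/=.
by rewrite -(subKn (ltnW xy)); apply: dn; rewrite leq_subr.
Qed.

Lemma lazy_walk_aperiodic : aperiodic p.
Proof.
move=> x m /(_ 1%N isT) h; apply/eqP; rewrite -dvdn1; apply: h.
apply: (chain_law_step (z := x) lazy_walk_stochastic) => /=.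
  by rewrite eqxx ltr01.
by rewrite /lazy_walk eqxx ltn_eqF// invr_gt0.
Qed.

Lemma lazy_walk_stationary_exists : exists pi, stationary p pi.
Proof.
pose v (i : nat) : R := \prod_(0 <= j < i) (e j / (1 - e j.+1)).
have v0 i : (i <= n)%N -> 0 < v i.
  move=> ni; rewrite /v big_nat_cond; apply: prodr_gt0 => j; rewrite andbT => /andP[_ ji].
  by rewrite divr_gt0 ?subr_gt0 ?reflected_env_lt1// reflected_env_gt0// (leq_trans ji).
have vS i : v i.+1 * (1 - e i.+1) = v i * e i.
  rewrite /v big_nat_recr//= -mulrA divfK// subr_eq0 eq_sym lt_eqF//.
  exact: reflected_env_lt1.
have bal (i j : 'I_n.+1) : v i * p i j = v j * p j i.
  rewrite /lazy_walk [i == j]eq_sym.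
  case: (eqVneq j i) => [->//|].
  rewrite -(inj_eq val_inj)/= => ji.
  case: (eqVneq (val j) i.+1) => [E|jS].
    have -> : (val i == j.+1) = false by rewrite E ltn_eqF.
    by rewrite E mulrA -vS mulrA.
  case: (eqVneq (val i) j.+1) => [E|iS]; last by rewrite !mulr0.
  by rewrite E !mulrA -vS.
pose Z : R := \sum_(i < n.+1) v i.
have Z0 : 0 < Z.
  rewrite /Z (bigD1 ord0)//= ltr_pwDl ?v0// sumr_ge0// => i _.
  by rewrite ltW// v0// -ltnS ltn_ord.
exists (fun i : 'I_n.+1 => v i / Z); split; first split.
- by move=> i; rewrite divr_ge0 ?ltW// v0// -ltnS ltn_ord.
- by rewrite -mulr_suml divff// gt_eqF.
move=> j; under eq_bigr do rewrite mulrAC bal mulrAC.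
rewrite -mulr_sumr; have [_ ->] := lazy_walk_stochastic j.
by rewrite mulr1.
Qed.

End Walk.
End LazyWalkIsChain.

(* Main.v *)
Require Import Defs.
From HB Require Import structures.
From mathcomp Require Import all_boot all_order all_algebra finmap.
From mathcomp Require Import all_classical all_reals all_analysis.
From mathcomp Require Import measurable_realfun ring lra.

Import Order.TTheory GRing.Theory Num.Theory.
Import numFieldNormedType.Exports.

Local Open Scope classical_set_scope.
Local Open Scope ring_scope.

(* Let tau_k be the expected crossing time of the edge {k, k+1} and S_n the sum
   of tau_0, ..., tau_(n-1), so that d_n(l) <= 4 S_n / l. The cut at k forces
   relaxation time of order tau_k as soon as {0..k} carries at most half of the
   stationary mass, and a relaxation time comparable to the mixing time excludes
   cutoff. So it suffices that, almost surely, infinitely often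
   tau_k >= eps S_(k+1) and the potential falls fast enough after k: n > k is
   then chosen so that {k+1..n} carries most of the mass while S_n = O(tau_k).

   For the first property put u_k = tau_k / S_(k+1). As tau_(k+1) >=
   rho_(k+1) tau_k and E rho > 1 (Jensen, kappa < 1), u grows geometrically in
   mean as long as u <= eps; since u <= 1, the sum of the u_k before the first
   k with u_k > eps has finite mean. But S_k -> oo forces this sum to diverge if
   there is no such k. The second property concerns the environment after k,
   which is independent of the exit time; its moment of order kappa / 2 is
   bounded because E rho^(kappa/2) < 1, and Fatou's lemma along the exit times
   after N = 0, 1, 2, ... gives a bound valid infinitely often. *)

(** * Reversible chains on a finite set *)

Section TransitionOperator.
Context {R : realType} {S : finType}.
Implicit Types (p : S -> S -> R) (f g : S -> R) (pi : S -> R).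

Definition transition p f (x : S) : R := \sum_y p x y * f y.

Lemma chain_law_sum p x l f :
  \sum_y chain_law p x l y * f y = iter l (transition p) f x.
Proof.
elim: l f => [|l IH] f /=.
  rewrite (bigD1 x)//= eqxx mul1r big1 ?addr0// => y /negbTE yx.
  by rewrite yx mul0r.
rewrite -iterS iterSr -IH.
under eq_bigr do rewrite mulr_suml.
rewrite exchange_big/=; apply: eq_bigr => z _.
by rewrite /transition mulr_sumr; apply: eq_bigr => y _; rewrite mulrA.
Qed.

Lemma chain_law_set p x l (A : {set S}) :
  \sum_(y in A) chain_law p x l y =
  iter l (transition p) (fun y => (y \in A)%:R) x.
Proof.
rewrite -chain_law_sum big_mkcond/=; apply: eq_bigr => y _.
by case: ifP; rewrite ?mulr1 ?mulr0.
Qed.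

Lemma tv_dist_ge mu nu (A : {set S}) :
  `|\sum_(x in A) mu x - \sum_(x in A) nu x| <= tv_dist mu nu :> R.
Proof.
exact: (le_bigmax 0 (fun B : {set S} => `|\sum_(x in B) mu x - \sum_(x in B) nu x|)). Qed.

Lemma dist_to_stat_ge p pi l x (A : {set S}) :
  `|\sum_(y in A) chain_law p x l y - \sum_(y in A) pi y| <= dist_to_stat p pi l.
Proof.
apply: (le_trans (tv_dist_ge _ _ A)).
exact: (le_bigmax 0 (fun z => tv_dist (chain_law p z l) pi)).
Qed.

Lemma dist_to_stat_le p pi l (c : R) : 0 <= c ->
  (forall x (A : {set S}),
    `|\sum_(y in A) chain_law p x l y - \sum_(y in A) pi y| <= c) ->
  dist_to_stat p pi l <= c.
Proof.
by move=> c0 H; apply: bigmax_le => // x _; apply: bigmax_le.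
Qed.

Lemma dist_to_stat_ge0 p pi l : 0 <= dist_to_stat p pi l.
Proof. exact: bigmax_ge_id. Qed.

Definition reversible p pi := forall x y, pi x * p x y = pi y * p y x.

Lemma transition_sym p pi f g : reversible p pi ->
  \sum_x pi x * (transition p f x * g x) = \sum_x pi x * (f x * transition p g x).
Proof.
move=> rev; rewrite /transition.
transitivity (\sum_x \sum_y pi x * p x y * f y * g x).
  by apply: eq_bigr => x _; rewrite mulr_suml mulr_sumr; apply: eq_bigr => y _; ring.
rewrite exchange_big/=; apply: eq_bigr => x _.
rewrite mulr_sumr mulr_sumr; apply: eq_bigr => y _.
by rewrite (rev y x); ring.
Qed.

Lemma transition_cst p c : stochastic p ->
  forall x, transition p (fun=> c) x = c :> R.
Proof. by move=> sp x; rewrite /transition -mulr_suml (sp x).2 mul1r. Qed.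

Lemma transition_sub p f g x :
  transition p (fun y => f y - g y) x = transition p f x - transition p g x.
Proof.
rewrite /transition -sumrB; apply: eq_bigr => y _; by rewrite mulrBr.
Qed.

Lemma iter_transition_sub_cst p f c l x : stochastic p ->
  iter l (transition p) (fun y => f y - c) x = iter l (transition p) f x - c.
Proof.
move=> sp; elim: l x => [//|l IH] x /=.
rewrite -[in RHS](transition_cst _ c sp x) -transition_sub.
by congr transition; apply/funext => y; rewrite IH.
Qed.

Lemma stationary_sum p pi f : (forall y, \sum_x pi x * p x y = pi y) ->
  \sum_x pi x * transition p f x = \sum_x pi x * f x.
Proof.
move=> st; rewrite /transition; under eq_bigr do rewrite mulr_sumr.
rewrite exchange_big/=; apply: eq_bigr => y _.
by rewrite -st mulr_suml; apply: eq_bigr => x _; rewrite mulrA.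
Qed.

Lemma iter_transition_norm1 p pi f l : stochastic p -> stationary p pi ->
  \sum_x pi x * `|iter l (transition p) f x| <= \sum_x pi x * `|f x|.
Proof.
move=> sp [[pi0 _] st]; elim: l => [//|l IH] /=; apply: le_trans IH.
rewrite -(@stationary_sum p pi (fun x => `|iter l (transition p) f x|))//.
apply: ler_sum => x _; apply: ler_wpM2l => //.
apply: (le_trans (ler_norm_sum _ _ _)); apply: ler_sum => y _.
by rewrite normrM (ger0_norm ((sp x).1 y)).
Qed.

(* With F = 1_A - pi A and b_l = |P^l F|_2^2, expanding
   |P^(l+1) F - th^2 P^(l-1) F|_2^2 >= 0 and using reversibility gives
   b_(l+1) - th^2 b_l >= th^2 (b_l - th^2 b_(l-1)); hence b_l >= th^(2l) b_0,
   whereas b_l <= d(l) |F|_1 = 2 b_0 d(l). *)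
Lemma dist_to_stat_lower p pi (A : {set S}) (a th : R) l :
  stochastic p -> stationary p pi -> reversible p pi ->
  \sum_(x in A) pi x = a -> 0 < a < 1 -> 0 <= th ->
  \sum_(x in A) \sum_(y | y \notin A) pi x * p x y <= (1 - th) * (a * (1 - a)) ->
  th ^+ (2 * l) / 2 <= dist_to_stat p pi l.
Proof.
move=> sp stt rev aA /andP[a0 a1] th0 flow.
have [[pi0 pi1] st] := stt.
have [ind indE] : exists ind : S -> R, forall x, ind x = (x \in A)%:R by eexists.
pose F x := ind x - a.
pose P := transition p.
pose b i := \sum_x pi x * (iter i P F x) ^+ 2.
have sumA (h : S -> R) : \sum_x pi x * (ind x * h x) = \sum_(x in A) pi x * h x.
  rewrite [RHS]big_mkcond/=; apply: eq_bigr => x _; rewrite indE.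
  by case: ifP => _; rewrite ?mul1r// mul0r mulr0.
have aE : \sum_x pi x * ind x = a.
  by rewrite -aA [RHS]big_mkcond/=; apply: eq_bigr => x _; rewrite indE;
    case: ifP => _; rewrite ?mulr1 ?mulr0.
have b0E : b 0%N = a * (1 - a).
  rewrite /b /= /F.
  transitivity (\sum_x (pi x * ind x - 2 * a * (pi x * ind x) + a ^+ 2 * pi x)).
    apply: eq_bigr => x _; have : ind x ^+ 2 = ind x.
      by rewrite indE; case: (x \in A); rewrite ?expr1n ?expr0n.
    move=> i2; have -> : (ind x - a) ^+ 2 = ind x ^+ 2 - 2 * a * ind x + a ^+ 2 by ring.
      by rewrite i2; ring.
  rewrite big_split sumrB/= -!mulr_sumr aE pi1 mulr1; ring.
have F1 : \sum_x pi x * `|F x| = 2 * b 0%N.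
  rewrite b0E; transitivity (\sum_x ((1 - 2 * a) * (pi x * ind x) + a * pi x)).
    apply: eq_bigr => x _; rewrite /F indE; case: (x \in A); rewrite ?mulr1n ?mulr0n.
      by rewrite ger0_norm ?subr_ge0 1?ltW//; ring.
    by rewrite sub0r normrN ger0_norm 1?ltW//; ring.
  by rewrite big_split/= -!mulr_sumr aE pi1; ring.
have b00 : 0 < b 0%N by rewrite b0E mulr_gt0// subr_gt0.
have D i : b i.+1 = \sum_x pi x * (iter i P F x * iter i.+2 P F x).
  by rewrite /b /= -[RHS]transition_sym.
(* The inner product <F, P F> is the variance a (1 - a) less the flow out of [A]. *)
have a1E : \sum_x pi x * (F x * P F x) =
    b 0%N - \sum_(x in A) \sum_(y | y \notin A) pi x * p x y.
  have PF x : P F x = P ind x - a by rewrite /P /F transition_sub transition_cst.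
  transitivity (\sum_x (pi x * (ind x * P ind x) - a * (pi x * ind x)
                        - a * (pi x * P ind x) + a ^+ 2 * pi x)).
    by apply: eq_bigr => x _; rewrite PF /F; ring.
  rewrite big_split/= !sumrB -!mulr_sumr aE pi1 /P stationary_sum// aE sumA.
  have -> : \sum_(x in A) pi x * transition p ind x =
     a - \sum_(x in A) \sum_(y | y \notin A) pi x * p x y.
    rewrite -aA -sumrB; apply: eq_bigr => x xA.
    rewrite -mulr_sumr -[X in X - _]mulr1 -mulrBr; congr (_ * _).
    rewrite -(sp x).2 [X in _ = X - _](bigID (mem A))/= addrK.
    rewrite /transition [RHS]big_mkcond/=; apply: eq_bigr => y _.
    by rewrite indE; case: ifP; rewrite ?mulr1 ?mulr0.
  by rewrite b0E; ring.
have sq0 (h : S -> R) : 0 <= \sum_x pi x * h x ^+ 2.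
  by apply: sumr_ge0 => x _; rewrite mulr_ge0// sqr_ge0.
(* Base case: the flow bound gives <F, P F> >= th |F|_2^2; then expand |P F - th F|_2^2 >= 0. *)
have b1 : th ^+ 2 * b 0%N <= b 1%N.
  have H1 : th * b 0%N <= \sum_x pi x * (F x * P F x).
    by rewrite a1E b0E; move: flow; lra.
  have H2 := sq0 (fun x => P F x - th * F x).
  have H3 : \sum_x pi x * (P F x - th * F x) ^+ 2 =
      b 1%N - 2 * th * (\sum_x pi x * (F x * P F x)) + th ^+ 2 * b 0%N.
    rewrite /b/= !mulr_sumr -sumrB -big_split/=; apply: eq_bigr => x _; ring.
  rewrite H3 in H2; nra.
have bS i : th ^+ 2 * b i <= b i.+1.
  elim: i => [//|i IH].
  have H2 := sq0 (fun x => iter i.+2 P F x - th ^+ 2 * iter i P F x).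
  have H3 : \sum_x pi x * (iter i.+2 P F x - th ^+ 2 * iter i P F x) ^+ 2 =
      b i.+2 - 2 * th ^+ 2 * b i.+1 + th ^+ 2 * (th ^+ 2 * b i).
    rewrite (D i) /b !mulr_sumr -sumrB -big_split/=; apply: eq_bigr => x _ /=; ring.
  rewrite H3 in H2.
  have := ler_wpM2l (sqr_ge0 th) IH; lra.
have bl i : th ^+ (2 * i) * b 0%N <= b i.
  elim: i => [|i IH]; first by rewrite muln0 expr0 mul1r.
  apply: le_trans (bS i); rewrite mulnS exprD -mulrA.
  by apply: ler_wpM2l => //; exact: sqr_ge0.
have ub : b l <= dist_to_stat p pi l * (2 * b 0%N).
  rewrite -F1; apply: (@le_trans _ _
      (dist_to_stat p pi l * \sum_x pi x * `|iter l P F x|)); last first.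
    by apply: ler_wpM2l; [exact: dist_to_stat_ge0|exact: iter_transition_norm1].
  rewrite mulr_sumr; apply: ler_sum => x _.
  rewrite [leRHS]mulrCA; apply: ler_wpM2l => //.
  rewrite -real_normK ?num_real// expr2.
  apply: ler_wpM2r => //.
  rewrite iter_transition_sub_cst// -aA (funext indE) -chain_law_set.
  exact: dist_to_stat_ge.
rewrite -(ler_pM2r b00); have := bl l; lra.
Qed.

End TransitionOperator.

(** * Crossing times and the lazy walk *)

(* tau r k is the expected crossing time of the edge {k, k+1} by the lazy walk
   reflected at 0, where r j = (1 - omega_j) / omega_j. *)
Fixpoint tau {R : realType} (r : nat -> R) (k : nat) : R :=
  if k is k'.+1 then 2 * (1 + r k'.+1) + r k'.+1 * tau r k' else 2.

Definition sum_tau {R : realType} (r : nat -> R) (n : nat) : R :=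
  \sum_(j < n) tau r j.

(** This is exp (V (k+i) - V k) for the potential V of the environment, whose increments are ln
    r. *)
Definition ratio_prod {R : realType} (r : nat -> R) (k i : nat) : R :=
  \prod_(j < i) r (k + j).+1.

Section PathStep.
Context {R : realType} (e : nat -> R) (n : nat).
Hypotheses (e01 : forall k, 0 <= e k <= 1) (e0 : e 0%N = 1) (en : e n = 0).

(** The walk's operator on functions on all of [nat]: the values read outside {0..n}, or at [0.-1],
    have weight 0 because e 0 = 1 and e n = 0. *)
Definition path_step (F : nat -> R) (k : nat) : R :=
  e k / 2 * F k.+1 + F k / 2 + (1 - e k) / 2 * F k.-1.

(* Couple the walks from x < y by letting, at each step, exactly one of the two
   move according to the non-lazy kernel, either one with probability 1/2: they
   cannot cross, and they have met when the lower one reaches n. *)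
Lemma path_step_coupling (F phi : nat -> R) (c al : R) :
  (forall x, 0 <= phi x) -> 0 <= c ->
  (forall x, (x < n)%N -> path_step phi x <= al * phi x) ->
  (forall x y, (x < y <= n)%N -> `|F x - F y| <= c * phi x) ->
  forall x y, (x < y <= n)%N ->
  `|path_step F x - path_step F y| <= c * al * phi x.
Proof.
move=> phi0 c0 sup H x y /andP[xy yn].
have /andP[ex0 ex1] := e01 x; have /andP[ey0 ey1] := e01 y.
have ex1' : 0 <= 1 - e x by rewrite subr_ge0.
have ey1' : 0 <= 1 - e y by rewrite subr_ge0.
have -> : path_step F x - path_step F y =
  2^-1 * (e x * (F x.+1 - F y) + (1 - e x) * (F x.-1 - F y)
  + (e y * (F x - F y.+1) + (1 - e y) * (F x - F y.-1))).
  by rewrite /path_step; field.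
have b1 : e x * `|F x.+1 - F y| <= e x * (c * phi x.+1).
  apply: ler_wpM2l => //; move: xy; rewrite leq_eqVlt => /orP[/eqP->|xy].
    by rewrite subrr normr0 mulr_ge0.
  by apply: H; rewrite xy.
have b2 : (1 - e x) * `|F x.-1 - F y| <= (1 - e x) * (c * phi x.-1).
  case: (posnP x) => [->|x0]; first by rewrite e0 subrr !mul0r.
  apply: ler_wpM2l => //; apply: H; rewrite yn andbT.
  by rewrite (leq_ltn_trans (leq_pred _)).
have b3 : e y * `|F x - F y.+1| <= e y * (c * phi x).
  move: yn; rewrite leq_eqVlt => /orP[/eqP->|yn]; first by rewrite en !mul0r.
  by apply: ler_wpM2l => //; apply: H; rewrite yn andbT ltnW.
have b4 : (1 - e y) * `|F x - F y.-1| <= (1 - e y) * (c * phi x).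
  apply: ler_wpM2l => //; have y0 : (0 < y)%N by apply: leq_trans xy.
  move: xy; rewrite -{1}(prednK y0) ltnS leq_eqVlt => /orP[/eqP->|xy].
    by rewrite subrr normr0 mulr_ge0.
  by apply: H; rewrite xy (leq_trans (leq_pred _)).
have tri : `|e x * (F x.+1 - F y) + (1 - e x) * (F x.-1 - F y)
  + (e y * (F x - F y.+1) + (1 - e y) * (F x - F y.-1))| <=
  e x * `|F x.+1 - F y| + (1 - e x) * `|F x.-1 - F y|
  + (e y * `|F x - F y.+1| + (1 - e y) * `|F x - F y.-1|).
  apply: (le_trans (ler_normD _ _)); apply: lerD;
    apply: (le_trans (ler_normD _ _)); rewrite !normrM;
    by rewrite (ger0_norm ex0, ger0_norm ey0) (ger0_norm ex1', ger0_norm ey1').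
have xn : (x < n)%N by apply: leq_trans yn.
have := ler_wpM2l c0 (sup x xn); rewrite /path_step normrM ger0_norm//.
move: b1 b2 b3 b4 tri; lra.
Qed.

(** [phi] is a Lyapunov function of the lower walk, so the oscillation of F decays at its rate until
    the two walks meet. *)
Lemma iter_path_step_coupling (F phi : nat -> R) (al : R) l :
  (forall x, 0 <= phi x) -> 0 <= al ->
  (forall x, (x < n)%N -> path_step phi x <= al * phi x) ->
  (forall x y, (x < y <= n)%N -> `|F x - F y| <= phi x) ->
  forall x y, (x < y <= n)%N ->
  `|iter l path_step F x - iter l path_step F y| <= al ^+ l * phi x.
Proof.
move=> phi0 al0 sup H; elim: l => [|l IH] x y xy; first by rewrite expr0 mul1r H.
rewrite !iterS exprSr; apply: path_step_coupling => //; exact: exprn_ge0.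
Qed.

End PathStep.

(** Turns the geometric decay (1 - y)^l into a bound of order 1 / (l y). *)
Lemma exprn_bernoulli (R : realType) (y : R) l :
  0 <= y <= 1 -> (1 - y) ^+ l * (1 + l%:R * y) <= 1.
Proof.
move=> /andP[y0 y1]; elim: l => [|l IH]; first by rewrite expr0 mul0r; lra.
apply: le_trans IH; rewrite exprSr -mulrA ler_wpM2l//.
  by rewrite exprn_ge0// subr_ge0.
rewrite -natr1; have : 0 <= l%:R * y * y by rewrite !mulr_ge0. nra.
Qed.

Section Crossing.
Context {R : realType} (r : nat -> R).
Hypothesis r0 : forall k, 0 < r k.

Lemma tau_ge2 k : 2 <= tau r k.
Proof.
elim: k => [//|k IH] /=.
have := r0 k.+1; have : 0 < r k.+1 * tau r k by rewrite mulr_gt0// (lt_le_trans _ IH).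
lra.
Qed.

Lemma tau_gt0 k : 0 < tau r k.
Proof. by apply: lt_le_trans (tau_ge2 k). Qed.

Lemma sum_tauS n : sum_tau r n.+1 = sum_tau r n + tau r n.
Proof. exact: big_ord_recr. Qed.

Lemma sum_tau_ge n : n%:R *+ 2 <= sum_tau r n.
Proof.
elim: n => [|n IH]; first by rewrite mul0rn /sum_tau big_ord0.
by rewrite sum_tauS -natr1 mulrnDl lerD// tau_ge2.
Qed.

Lemma ler_sum_tau m n : (m <= n)%N -> sum_tau r m <= sum_tau r n.
Proof.
move=> /subnK<-; elim: (n - m)%N => [//|i IH].
by rewrite addSn sum_tauS (le_trans IH)// lerDl ltW// tau_gt0.
Qed.

Lemma ratio_prod_gt0 k i : 0 < ratio_prod r k i.
Proof. by apply: prodr_gt0. Qed.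

Lemma ratio_prodS k i : ratio_prod r k i.+1 = ratio_prod r k i * r (k + i).+1.
Proof. exact: big_ord_recr. Qed.

(* tau (k+i) / ratio_prod k i increases by 2 / ratio_prod k i.-1 +
   2 / ratio_prod k i at step i. *)
Lemma tau_shift_le k i :
  tau r (k + i)%N <=
  ratio_prod r k i * (tau r k + 2 + 4 * \sum_(j < i.-1) (ratio_prod r k j.+1)^-1)
  + 2.
Proof.
suff H i' : tau r (k + i'.+1)%N = ratio_prod r k i'.+1 *
   (tau r k + 2 + 4 * \sum_(j < i') (ratio_prod r k j.+1)^-1) + 2.
  case: i => [|i]; last by rewrite H.
  rewrite addn0 /ratio_prod !big_ord0; have := tau_gt0 k; lra.
elim: i' => [|i' IH].
  by rewrite addn1 /= /ratio_prod big_ord_recr !big_ord0/= addn0; ring.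
rewrite addnS /= IH big_ord_recr/= (ratio_prodS k i'.+1) addnS.
have := ratio_prod_gt0 k i'.+1; move=> /lt0r_neq0 nz; field.
exact: nz.
Qed.

(** Take the least m satisfying the first claim. Before m the sum of inverse products is below
    [tau r k], so [tau_shift_le] bounds each later crossing time by a product times 5 tau_k + 2,
    plus 2. The products sum to at most q, and m is at most q tau_k + 1. *)
Lemma sum_tau_after k (q : R) : 0 < q ->
  (forall m, \sum_(i < m) ratio_prod r k i.+1 <= q) ->
  exists m, tau r k <= \sum_(i < m) (ratio_prod r k i.+1)^-1 /\
    sum_tau r (k.+1 + m) <= sum_tau r k.+1 + (8 * q + 1) * tau r k.
Proof.
move=> q0 Hq.
(* Each product is a term of a sum bounded by q, so its inverse is at least 1 / q. *)
have lb m : m%:R / q <= \sum_(i < m) (ratio_prod r k i.+1)^-1.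
  rewrite mulr_natl -[X in _ *+ X](card_ord m) -sumr_const.
  apply: ler_sum => i _; rewrite lef_pV2 ?posrE ?ratio_prod_gt0//.
  apply: le_trans (Hq i.+1); rewrite big_ord_recr/= lerDr.
  by apply: sumr_ge0 => j _; rewrite ltW// ratio_prod_gt0.
have ex : exists m, tau r k <= \sum_(i < m) (ratio_prod r k i.+1)^-1.
  exists (Num.truncn (tau r k * q)).+1; apply: le_trans (lb _).
  by rewrite ler_pdivlMr// ltW// truncnS_gt.
have /= := ex_minnP ex; case=> m Hm min; exists m; split => //.
have lt i : (i < m)%N -> \sum_(j < i) (ratio_prod r k j.+1)^-1 < tau r k.
  by move=> im; rewrite ltNge; apply/negP => /min; rewrite leqNgt im.
have t2 := tau_ge2 k.
have sumE m' : sum_tau r (k.+1 + m') =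
    sum_tau r k.+1 + \sum_(i < m') tau r (k + i.+1)%N.
  elim: m' => [|m' IH]; first by rewrite addn0 big_ord0 addr0.
  by rewrite addnS sum_tauS IH big_ord_recr/= -addrA addnS.
rewrite sumE lerD2l.
apply: (@le_trans _ _ (\sum_(i < m) (ratio_prod r k i.+1 * (5 * tau r k + 2) + 2))).
  apply: ler_sum => i _; apply: (le_trans (tau_shift_le k i.+1)).
  rewrite lerD2r ler_wpM2l ?(ltW (ratio_prod_gt0 _ _))//=.
  have := lt i (ltn_ord i); lra.
rewrite big_split/= -mulr_suml sumr_const card_ord.
have H1 : (\sum_(i < m) ratio_prod r k i.+1) * (5 * tau r k + 2) <=
    q * (5 * tau r k + 2) by rewrite ler_wpM2r//; lra.
have H2 : 2 *+ m <= 2 * (q * tau r k) + 2.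
  case: m {Hm min H1} lt => [|m] lt; first by rewrite mulr0n; nra.
  have := le_lt_trans (lb m) (lt m (ltnSn m)).
  by rewrite ltr_pdivrMr// mulrS -mulr_natl => h; nra.
(* As tau_k >= 2, q (5 tau_k + 2) + 2 q tau_k + 2 <= (8 q + 1) tau_k. *)
apply: (le_trans (lerD H1 H2)); nra.
Qed.

End Crossing.

(** * Stationary distribution, bottleneck and mixing of the lazy walk *)

Section PathStationary.
Context {R : realType} (w : int -> R) (n : nat) (pi : 'I_n.+1 -> R).
Hypotheses (w01 : forall k, 0 < w k < 1) (n0 : (0 < n)%N)
  (stat : stationary (@lazy_walk R w n) pi).

Local Notation e := (reflected_env w n).
Local Notation p := (@lazy_walk R w n).
Local Notation r := (fun k : nat => rho (w k%:Z)).
Local Notation P k := (pi (inord k)).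

Lemma sum_delta (k : nat) (F : nat -> R) :
  \sum_(j < n.+1) (val j == k)%:R * F j = (k < n.+1)%:R * F k.
Proof.
rewrite -sum_pick; apply: eq_bigr => j _.
by case: eqVneq => [->|_]; rewrite ?mul0r.
Qed.

Lemma transition_lazy_walk (F : nat -> R) :
  transition p (fun i => F i) = (fun i => path_step e F i).
Proof.
apply/funext => i; rewrite /transition /path_step.
transitivity (\sum_(j < n.+1) ((val j == i.+1)%:R * (e i / 2 * F j)
   + (val j == i)%:R * (F j / 2)
   + (val i == j.+1)%:R * ((1 - e i) / 2 * F j))).
  by apply: eq_bigr => j _; rewrite lazy_walkE -(inj_eq val_inj); ring.
rewrite !big_split/= (sum_delta _ (fun j => e i / 2 * F j)).
rewrite (sum_delta _ (fun j => F j / 2)) ltn_ord mul1r; congr (_ + _ + _).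
  case: (ltnP i n) => ni; first by rewrite ltnS ni mul1r.
  have -> : nat_of_ord i = n by apply/eqP; rewrite eqn_leq ni -ltnS ltn_ord.
  by rewrite reflected_envn// !mul0r mulr0.
case: (posnP i) => [i0|i0].
  by rewrite i0 reflected_env0 subrr !mul0r; apply: big1 => j _; rewrite !mul0r.
under eq_bigr do rewrite -[X in X == _](prednK i0) eqSS eq_sym.
rewrite (sum_delta _ (fun j => (1 - e i) / 2 * F j)).
by rewrite (leq_ltn_trans (leq_pred _) (ltn_ord i)) mul1r.
Qed.

Lemma iter_transition_lazy_walk (F : nat -> R) l :
  iter l (transition p) (fun i => F i) = (fun i => iter l (path_step e) F i).
Proof. by elim: l => [//|l IH]; rewrite !iterS IH transition_lazy_walk. Qed.

Lemma stationary_lazy_walk k : (k <= n)%N ->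
  P k = (0 < k)%:R * (P k.-1 * (e k.-1 / 2)) + P k / 2
        + (k < n)%:R * (P k.+1 * ((1 - e k.+1) / 2)).
Proof.
move=> kn; rewrite -[LHS](stat.2 (inord k)).
transitivity (\sum_(j < n.+1) ((k == j.+1)%:R * (P j * (e j / 2))
   + (val j == k)%:R * (P j / 2)
   + (val j == k.+1)%:R * (P j * ((1 - e j) / 2)))).
  apply: eq_bigr => j _.
  by rewrite lazy_walkE -(inj_eq val_inj)/= inordK// inord_val [k == j]eq_sym; ring.
rewrite !big_split/= (sum_delta _ (fun j => P j / 2)) ltnS kn mul1r.
rewrite (sum_delta _ (fun j => P j * ((1 - e j) / 2))) ltnS; congr (_ + _ + _).
case: k kn => [|k] kn; first by rewrite mul0r big1// => j _; rewrite mul0r.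
under eq_bigr do rewrite eqSS eq_sym.
by rewrite (sum_delta _ (fun j => P j * (e j / 2))) ltnW.
Qed.

(** Induction from the left end: the balance equation at k, less detailed balance on the edge to its
    left, leaves detailed balance on the edge to its right. *)
Lemma lazy_walk_cut k : (k < n)%N -> P k * e k = P k.+1 * (1 - e k.+1).
Proof.
elim: k => [|k IH] kn; have := stationary_lazy_walk _ (ltnW kn);
  rewrite kn mul1r/=.
  by rewrite mul0r reflected_env0; lra.
by rewrite mul1r; have := IH (ltnW kn); lra.
Qed.

Lemma lazy_walk_reversible : reversible p pi.
Proof.
have cut (i j : 'I_n.+1) : val j = i.+1 -> pi i * p i j = pi j * p j i.
  rewrite /= => ij; have iN : (i < n)%N by rewrite -ltnS -ij ltn_ord.
  rewrite !lazy_walkE -!(inj_eq val_inj)/= ij eqxx.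
  rewrite (gtn_eqF (ltnSn _)) (ltn_eqF (ltnSn _)) (ltn_eqF (leqW (ltnSn _))).
  have := lazy_walk_cut _ iN; rewrite -ij !inord_val !mul0r /= mulr1n; lra.
move=> i j; case: (eqVneq (val j) i.+1) => [/cut//|ij].
case: (eqVneq (val i) j.+1) => [/cut//|ji].
case: (eqVneq i j) => [->//|].
by rewrite !lazy_walkE [j == i]eq_sym (negbTE ij) (negbTE ji) => /negbTE->;
  rewrite !mul0r !addr0 !mulr0.
Qed.

Lemma lazy_walk_stationary_gt0 k : (k <= n)%N -> 0 < P k.
Proof.
have [[pi0 pi1] _] := stat.
have pos k' : (k' < n)%N -> (0 < P k'.+1) = (0 < P k').
  move=> kn; have := lazy_walk_cut _ kn; have := reflected_env_gt0 w01 kn.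
  have := @reflected_env_lt1 R w n w01 k'.+1 isT; rewrite -subr_gt0 => a b c.
  by rewrite -(pmulr_lgt0 _ a) -c pmulr_lgt0.
have all0 k' : (k' <= n)%N -> (0 < P k') = (0 < P 0%N).
  by elim: k' => [//|k' IH] kn; rewrite pos// IH// ltnW.
move=> kn; rewrite all0// lt0r pi0 andbT; apply/eqP => P0.
have : \sum_x pi x = 0.
  apply: big1 => x _; apply/eqP; rewrite eq_le pi0 andbT leNgt.
  by rewrite -[x]inord_val all0 ?P0 ?ltxx// -ltnS ltn_ord.
by rewrite pi1 => /eqP; rewrite oner_eq0.
Qed.

Lemma rho_env k : (0 < k < n)%N -> rho (w k%:Z) * e k = 1 - e k.
Proof.
move=> /andP[k0 kn]; rewrite /reflected_env gtn_eqF// ltn_eqF// /rho divfK//.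
by case/andP: (w01 k%:Z) => /lt0r_neq0.
Qed.

Lemma rho_gt0 k : 0 < rho (w k).
Proof. by case/andP: (w01 k) => a b; rewrite divr_gt0// subr_gt0. Qed.

(** By detailed balance the flow through an edge is rho at its right end times the flow through the
    next edge. Hence the mass of {0..k} divided by the flow out of it satisfies the recursion of
    [tau]. *)
Lemma stationary_mass_le k : (k < n)%N ->
  \sum_(i < k.+1) P i = tau r k * (P k * e k / 2).
Proof.
elim: k => [|k IH] kn; first by rewrite big_ord_recr big_ord0/= reflected_env0; field.
rewrite big_ord_recr/= IH 1?ltnW// lazy_walk_cut 1?ltnW//.
rewrite -(rho_env k.+1)//; have := congr1 (fun z => P k.+1 * z) (rho_env k.+1 kn).
by rewrite /=; lra.
Qed.

Lemma edge_flow_shift k i : (k + i < n)%N ->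
  P (k + i) * e (k + i)%N * ratio_prod r k i = P k * e k.
Proof.
elim: i => [|i IH] kin; first by rewrite addn0 /ratio_prod big_ord0 mulr1.
have kin' : (k + i < n)%N by rewrite -ltnS -addnS ltnW.
rewrite -IH// (lazy_walk_cut _ kin') -addnS -(rho_env (k + i.+1)) ?kin ?addnS//.
by rewrite ratio_prodS -addnS; ring.
Qed.

(* The cut between {0..k} and its complement is a bottleneck: the flow through
   it is the mass of {0..k} divided by tau k. *)
Lemma dist_to_stat_lazy_walk_lower k m l : n = (k.+1 + m)%N -> 2 < tau r k ->
  tau r k <= \sum_(i < m) (ratio_prod r k i.+1)^-1 ->
  (1 - 2 / tau r k) ^+ (2 * l) / 2 <= dist_to_stat p pi l.
Proof.
move=> nE t2 tm; have kn : (k < n)%N by rewrite nE addSn ltnS leq_addr.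
have [[pi0 pi1] _] := stat.
pose flow := P k * e k / 2.
have f0 : 0 < flow.
  by rewrite divr_gt0// mulr_gt0// ?lazy_walk_stationary_gt0 1?ltnW// reflected_env_gt0.
have sumn : \sum_(i < n.+1) P i = 1.
  by rewrite -pi1; apply: eq_bigr => i _; rewrite inord_val.
(* {0..k} has at most half the mass of its complement: pi (k+i) >= pi (k+i) e (k+i) = 2 flow /
   [ratio_prod r k i], and the inverse products sum to at least tau_k. *)
have Hb : 2 * (tau r k * flow) <= 1 - tau r k * flow.
  have -> : 1 - tau r k * flow = \sum_(i < m.+1) P (k.+1 + i)%N.
    have split (F : nat -> R) : \sum_(i < n.+1) F i =
        \sum_(i < k.+1) F i + \sum_(i < m.+1) F (k.+1 + i)%N.
      by rewrite nE -addnS big_split_ord.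
    by rewrite -stationary_mass_le// -sumn (split (fun i => P i)) addrC addKr.
  rewrite big_ord_recr/= ler_wpDr//.
  apply: (@le_trans _ _ (\sum_(i < m) 2 * flow * (ratio_prod r k i.+1)^-1)).
    by rewrite -mulr_sumr mulrA mulrAC ler_wpM2l//; lra.
  apply: ler_sum => i _; rewrite ler_pdivrMr ?ratio_prod_gt0//; last exact: rho_gt0.
  have ki : (k + i.+1 < n)%N by rewrite nE addSnnS ltn_add2l ltnS ltn_ord.
  rewrite /flow mulrC divfK// -(edge_flow_shift _ _ ki) addSnnS.
  rewrite ler_wpM2r ?(ltW (ratio_prod_gt0 _ _ _ _))//; first exact: rho_gt0.
  by rewrite ger_pMr ?lazy_walk_stationary_gt0 1?ltnW//;
    case/andP: (reflected_env_bounds n w01 (k + i.+1)).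
have tf : 0 < tau r k * flow by rewrite mulr_gt0//; lra.
pose A : {set 'I_n.+1} := [set i : 'I_n.+1 | (i <= k)%N]%SET.
have aE : \sum_(x in A) pi x = tau r k * flow.
  rewrite -stationary_mass_le// (big_ord_widen n.+1 (fun i => P i)) 1?ltnW//.
  apply: eq_big => [i|i _]; first by rewrite inE ltnS.
  by rewrite inord_val.
apply: (dist_to_stat_lower p pi A (tau r k * flow)) => //.
- exact: lazy_walk_stochastic.
- exact: lazy_walk_reversible.
- by rewrite tf/=; lra.
- by rewrite subr_ge0 ler_pdivrMr; lra.
have kI : (k < n.+1)%N by rewrite ltnW.
have kI1 : (k.+1 < n.+1)%N by rewrite ltnS.
(* Jumps go to neighbours only, so the edge from k to k+1 carries all the flow out of [A]. *)
rewrite (bigD1 (inord k)) ?inE ?inordK//= [X in _ + X]big1 ?addr0; last first.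
  move=> x; rewrite inE -(inj_eq val_inj)/= inordK// => /andP[xk xnk].
  apply: big1 => y; rewrite inE -ltnNge => ky.
  have xk' : (x < k)%N by rewrite ltn_neqAle xnk.
  have xy := leq_ltn_trans xk' ky.
  rewrite lazy_walkE -(inj_eq val_inj)/= gtn_eqF// gtn_eqF 1?ltnW//.
  by rewrite ltn_eqF 1?ltnW// 1?ltnW// !mul0r !addr0 mulr0.
rewrite (bigD1 (inord k.+1)) ?inE ?inordK// -?ltnNge//= [X in _ + X]big1 ?addr0; last first.
  move=> y; rewrite inE -ltnNge -(inj_eq val_inj)/= inordK// => /andP[ky yk].
  rewrite lazy_walkE -(inj_eq val_inj)/= inordK// (negbTE yk) gtn_eqF//.
  by rewrite ltn_eqF 1?ltnW// !mul0r !addr0 mulr0.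
rewrite lazy_walkE -(inj_eq val_inj)/= !inordK// eqxx (gtn_eqF (ltnSn _)).
rewrite (ltn_eqF (leqW (ltnSn _))) !mul0r !addr0 mul1r mulrA -/flow.
move: Hb t2; set t : R := tau _ k => Hb t2.
(* For th = 1 - 2 / t the flow condition reads flow <= 2 flow (1 - t flow); it holds since the mass
   t flow is at most 1/3. *)
have -> : (1 - (1 - 2 / t)) * (t * flow * (1 - t * flow)) =
    2 * flow * (1 - t * flow).
  have tn : t != 0 by rewrite lt0r_neq0//; apply: lt_trans t2.
  by field.
have := f0; nra.
Qed.

(** The coupled walks have met once the lower one reaches n, which takes an expected time of at most
    S = [sum_tau r n]. A Lyapunov function built from this hitting time makes the oscillation decay
    like (1 - 1 / (2 S))^l. *)
Lemma dist_to_stat_lazy_walk_upper l :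
  l%:R * dist_to_stat p pi l <= 4 * sum_tau r n.
Proof.
have [[pi0 pi1] st] := stat.
have r0 (k : nat) : 0 < r k by exact: rho_gt0.
pose S := sum_tau r n.
have S2 : 2 <= S.
  apply: le_trans (sum_tau_ge r r0 n); rewrite lerMn2r/=.
  by rewrite ler1n.
(* S - [sum_tau r k] is the expected time to reach n from k, so one step lowers [phi] by 1 / S on
   average. As 1 <= phi <= 2, this is a contraction by 1 - 1 / (2 S). *)
pose phi k := 1 + (S - sum_tau r (minn k n)) / S.
have phi1 k : 1 <= phi k.
  rewrite /phi lerDl divr_ge0//; last by lra.
  by rewrite subr_ge0 (ler_sum_tau r r0)// geq_minr.
have phi2 k : phi k <= 2.
  rewrite /phi; have : (S - sum_tau r (minn k n)) / S <= 1.
    rewrite ler_pdivrMr; last by lra.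
    have : 0 <= sum_tau r (minn k n) by apply: sumr_ge0 => j _; rewrite ltW// tau_gt0.
    lra.
  lra.
pose al := 1 - (2 * S)^-1.
have S0 : 0 < (2 * S)^-1 by rewrite invr_gt0; lra.
have S1 : (2 * S)^-1 <= 1 by rewrite invf_le1; lra.
have sup x : (x < n)%N -> path_step e phi x <= al * phi x.
  move=> xn.
  have stepE : path_step e phi x = phi x - S^-1.
    rewrite /path_step /phi (minn_idPl xn) (minn_idPl (ltnW xn)).
    rewrite (minn_idPl (leq_trans (leq_pred _) (ltnW xn))) sum_tauS.
    case: x xn => [|x] xn.
      by rewrite reflected_env0 /=; field; lra.
    have ET : e x.+1 * tau r x.+1 = 2 + (1 - e x.+1) * tau r x.
      by rewrite -(rho_env x.+1)//=; have := rho_env x.+1 xn; rewrite /=; nra.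
    have SN : S != 0 by rewrite lt0r_neq0//; lra.
    move: (e x.+1) (tau r x.+1) ET => E T' ET; rewrite [x.+1.-1]/= (sum_tauS _ x).
    transitivity (1 + (S - (sum_tau r x + tau r x)) / S
       - (E * T' - (1 - E) * tau r x) / 2 / S); first by field.
    by rewrite ET; field.
  rewrite stepE /al mulrBl mul1r lerB// invfM.
  rewrite -[leRHS]mul1r; have := phi2 x.
  have : 0 < S^-1 by rewrite invr_gt0; lra.
  nra.
have al0 : 0 <= al by rewrite /al subr_ge0.
have main : dist_to_stat p pi l <= 2 * al ^+ l.
  apply: dist_to_stat_le => [|x A]; first by rewrite mulr_ge0// exprn_ge0.
  pose F (k : nat) : R := ((inord k : 'I_n.+1) \in A)%:R.
  have FA : (fun y => (y \in A)%:R) = (fun i : 'I_n.+1 => F i).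
    by apply/funext => i; rewrite /F inord_val.
  rewrite chain_law_set FA.
  (* By stationarity pi A is the pi-average of P^l F, so the distance is an average of differences
     of P^l F. *)
  have -> : \sum_(y in A) pi y = \sum_y pi y * iter l (transition p) (fun i : 'I_n.+1 => F i) y.
    transitivity (\sum_y pi y * F y).
      rewrite big_mkcond/=; apply: eq_bigr => y _; rewrite /F inord_val.
      by case: ifP; rewrite ?mulr1 ?mulr0.
    by elim: l => [//|l ->]; rewrite iterS stationary_sum.
  have avg c : c = \sum_y pi y * c by rewrite -mulr_suml pi1 mul1r.
  rewrite iter_transition_lazy_walk (avg (iter _ _ _ _)) -sumrB.
  apply: (le_trans (ler_norm_sum _ _ _)).
  rewrite [leRHS]avg; apply: ler_sum => y _.
  rewrite -mulrBr normrM ger0_norm// ler_wpM2l//.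
  have coup := @iter_path_step_coupling R e n (reflected_env_bounds n w01)
    (reflected_env0 w n) (reflected_envn w n0) F phi al l
    (fun k => le_trans ler01 (phi1 k)) al0 sup.
  have F01 x' y' : (x' < y' <= n)%N -> `|F x' - F y'| <= phi x'.
    move=> _; apply: le_trans (phi1 _); rewrite /F.
    by do 2 case: (_ \in _); rewrite /= ?subrr ?subr0 ?sub0r ?normrN ?normr0 ?normr1.
  have {}coup x' y' : (x' < y' <= n)%N ->
     `|iter l (path_step e) F x' - iter l (path_step e) F y'| <= 2 * al ^+ l.
    move=> h; apply: le_trans (coup F01 _ _ h) _; rewrite mulrC ler_wpM2r//.
    exact: exprn_ge0.
  move=> /=; case: (ltngtP x y) => xy.
  - by apply: coup; rewrite xy -ltnS ltn_ord.
  - by rewrite distrC; apply: coup; rewrite xy -ltnS ltn_ord.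
  - by rewrite xy subrr normr0 mulr_ge0// exprn_ge0.
apply: (le_trans (ler_wpM2l (ler0n _ l) main)).
have := @exprn_bernoulli R (2 * S)^-1 l.
rewrite -/al S1 (ltW S0) => /(_ isT); rewrite -/S.
have : 0 <= al ^+ l by rewrite exprn_ge0.
have : l%:R = l%:R / (2 * S) * (2 * S).
  by rewrite divfK// lt0r_neq0// mulr_gt0// (lt_le_trans _ S2).
set z := l%:R / (2 * S); move: (al ^+ l) => a lE a0 h.
have : a * z <= 1 by move: h; rewrite mulrDr mulr1; lra.
rewrite lE; nra.
Qed.

End PathStationary.

(** * A criterion against cutoff *)

(** Boundedness ensures that the real suprema defining [limn_sup] are genuine upper bounds. *)
Lemma limn_sup_lt (R : realType) (u : R^nat) (a : R) :
  bounded_fun u -> limn_sup u < a -> \forall n \near \oo, u n < a.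
Proof.
move=> bu; rewrite limn_supE// => ua.
have ub := bounded_fun_has_ubound bu.
have H := cvg_sups_inf ub (bounded_fun_has_lbound bu).
have : \forall n \near \oo, sups u n < a by apply: cvgr_lt ua; exact: H.
apply: filterS => n; apply: le_lt_trans.
apply: ub_le_sup; last by exists n => /=.
by apply: subset_has_ubound ub => _ [m _ <-]; exists m.
Qed.

Lemma limn_inf_gt (R : realType) (u : R^nat) (a : R) :
  bounded_fun u -> a < limn_inf u -> \forall n \near \oo, a < u n.
Proof.
move=> bu; rewrite limn_infE// => ua.
have lb := bounded_fun_has_lbound bu.
have H := cvg_infs_sup (bounded_fun_has_ubound bu) lb.
have : \forall n \near \oo, a < infs u n by apply: cvgr_gt ua; exact: H.
apply: filterS => n /lt_le_trans; apply.
apply: ge_inf; last by exists n => /=.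
by apply: subset_has_lbound lb => _ [m _ <-]; exists m.
Qed.

Lemma dist_to_stat_le1 (R : realType) (S : finType) (p : S -> S -> R) pi l :
  stochastic p -> is_distr pi -> dist_to_stat p pi l <= 1.
Proof.
move=> sp [pi0 pi1]; apply: dist_to_stat_le => // x A.
have cs l' y : \sum_z chain_law p y l' z = 1 :> R.
  transitivity (\sum_z chain_law p y l' z * 1).
    by apply: eq_bigr => z _; rewrite mulr1.
  rewrite (chain_law_sum p y l' (fun=> 1)); elim: l' y => [//|l' IH] y.
  by rewrite iterS (funext IH) transition_cst.
have H (mu : S -> R) : (forall z, 0 <= mu z) -> \sum_z mu z = 1 ->
    0 <= \sum_(y in A) mu y <= 1.
  move=> m0 <-; rewrite sumr_ge0//= [leRHS](bigID (mem A))/= lerDl.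
  exact: sumr_ge0.
have /andP[a b] := H _ pi0 pi1.
have /andP[c e] := H _ (chain_law_ge0 sp x l) (cs l x).
by rewrite ler_norml; lra.
Qed.

(** Take inverses: 1 / (1 - y) <= 1 + 2 y <= exp (2 y) on this range. *)
Lemma expR_le_1B (R : realType) (y : R) : 0 <= y <= 2^-1 -> expR (- (2 * y)) <= 1 - y.
Proof.
move=> /andP[y0 y1]; have y2 : 0 < 1 - y by lra.
rewrite expRN -[leRHS]invrK lef_pV2 ?posrE ?expR_gt0 ?invr_gt0//.
apply: le_trans (expR_ge1Dx _).
rewrite -[leLHS]mul1r ler_pdivrMr//; nra.
Qed.

Section NoCutoff.
Context {R : realType} (S : nat -> finType) (p : forall n, S n -> S n -> R)
  (pi : forall n, S n -> R).
Local Notation d n := (dist_to_stat (p n) (pi n)).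

(** A single c serves both limits; f = o(t) then keeps the two times within a constant factor, while
    the distance falls from above 1/2 to below any prescribed [eta]. *)
Lemma exhibits_cutoff_near (t f : nat -> R) (eta : R) :
  (forall n, (0 < n)%N -> stochastic (p n) /\ is_distr (pi n)) -> 0 < eta ->
  exhibits_cutoff p pi t f ->
  exists c : R, \forall n \near \oo,
   [/\ `|c * f n| <= `|t n| / 2, 2^-1 < d n (Num.truncn (t n - c * f n))
     & d n (Num.truncn (t n + c * f n)) < eta].
Proof.
move=> H eta0 [fo Hinf Hsup].
(* Nothing is assumed of the chain at n = 0, hence the extra term in the bound. *)
have bd (s : nat -> nat) : bounded_fun (fun n => d n (s n)).
  exists (1 + d 0%N (s 0%N)); split; first exact: num_real.
  move=> M M1 n _ /=; rewrite ger0_norm ?dist_to_stat_ge0//.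
  apply: le_trans (ltW M1); case: n => [|n]; first by rewrite lerDr.
  have [sp dp] := H n.+1 isT.
  by rewrite (le_trans (dist_to_stat_le1 _ _ _ _ _ sp dp))// lerDl dist_to_stat_ge0.
have A : \forall c \near +oo, 2^-1 < limn_inf (fun n => d n (Num.truncn (t n - c * f n))).
  by apply: (cvgr_gt _ Hinf); rewrite invf_lt1// ltr1n.
have B : \forall c \near +oo, limn_sup (fun n => d n (Num.truncn (t n + c * f n))) < eta.
  exact: (cvgr_lt _ Hsup).
have : \forall c \near (+oo : set_system R), 0 < c by exact: nbhs_pinfty_gt.
move=> C; have [c [[A' B'] c0]] := filter_ex (filterI (filterI A B) C).
exists c.
have {A'}A := limn_inf_gt _ _ _ (bd _) A'.
have {B'}B := limn_sup_lt _ _ _ (bd _) B'.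
have F : \forall n \near \oo, `|f n| <= (2 * c)^-1 * `|t n|.
  by move/eqoP: fo => /(_ (2 * c)^-1); apply; rewrite invr_gt0 mulr_gt0.
near=> n; split; try by near: n.
rewrite normrM gtr0_norm// -ler_pdivlMl//.
have : `|f n| <= (2 * c)^-1 * `|t n| by near: n.
by have -> : (2 * c)^-1 * `|t n| = c^-1 * (`|t n| / 2) by field; rewrite lt0r_neq0.
Unshelve. all: by end_near. Qed.

End NoCutoff.

(* Along the given k the chain on {0..n}, for a suitable n > k, mixes in time
   O(sum_tau n) = O(tau k), whereas its relaxation time is of order tau k. *)
Lemma no_cutoff (R : realType) (w : int -> R) (eps q : R) :
  (forall k, 0 < w k < 1) -> 0 < eps -> 0 < q ->
  let r := fun k : nat => rho (w k%:Z) in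
  (forall N, exists k, [/\ (N <= k)%N, eps * sum_tau r k.+1 <= tau r k &
     forall m, \sum_(i < m) ratio_prod r k i.+1 <= q]) ->
  forall pi : forall n : nat, 'I_n.+1 -> R,
  (forall n : nat, (0 < n)%N -> stationary (@lazy_walk R w n) (pi n)) ->
  ~ exists t f : nat -> R, exhibits_cutoff (@lazy_walk R w) pi t f.
Proof.
move=> w01 eps0 q0 r H pi stat [t [f cut]].
have r0 k : 0 < r k by exact: rho_gt0.
(* Chosen so that [sum_tau r n] <= C tau_k: 1 / eps accounts for the edges up to k, 8 q + 1 for
   those after it. *)
pose C := eps^-1 + 8 * q + 1.
have C0 : 0 < C by rewrite /C; have : 0 < eps^-1 by [rewrite invr_gt0]; lra.
(* The later time L is at most 52 C tau_k, and (1 - 2 / tau_k)^(2 L) >= exp (- 8 L / tau_k); 416 = 8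
   * 52. *)
pose eta := expR (- (416 * C)) / 2.
have eta0 : 0 < eta by rewrite divr_gt0// expR_gt0.
have [|c] := exhibits_cutoff_near _ _ _ _ _ _ _ eta0 cut.
  move=> n n0; split; first exact: lazy_walk_stochastic.
  by case: (stat n n0).
case=> N _ HN.
(* Since tau_k >= eps S_(k+1) >= 2 eps (k+1), k >= 2 / eps forces tau_k >= 4, as [expR_le_1B]
   requires for y = 2 / tau_k. *)
have [k [Nk ek qk]] := H (N + (Num.truncn (2 / eps)).+1)%N.
have [m [mt mS]] := sum_tau_after r r0 k q q0 qk.
pose n := (k.+1 + m)%N.
have n0 : (0 < n)%N by [].
have Nn : (N <= n)%N.
  by rewrite /n addSn (leq_trans _ (leqnSn _))//
    (leq_trans _ (leq_addr _ _))// (leq_trans _ Nk)// leq_addr.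
have t4 : 4 <= tau r k.
  apply: le_trans ek; rewrite -ler_pdivrMl//.
  apply: le_trans (sum_tau_ge r r0 k.+1).
  have -> : eps^-1 * 4 = (2 / eps) *+ 2 by rewrite -mulr_natr; field; rewrite lt0r_neq0.
  rewrite lerMn2r/=; apply: (le_trans (ltW (truncnS_gt _))).
  by rewrite ler_nat ltnW// ltnS (leq_trans _ Nk)// leq_addl.
have SC : sum_tau r n <= C * tau r k.
  apply: (le_trans mS); rewrite /C -(addrA eps^-1) (mulrDl eps^-1) lerD2r.
  by rewrite ler_pdivlMl.
have [cf dlo dhi] := HN n Nn.
have st := stat n n0.
(* A negative t_n would make both times round to 0, where the distance cannot be both above 1/2 and
   below [eta] <= 1/2. *)
have t0 : 0 <= t n.
  rewrite leNgt; apply/negP => tn0.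
  have z (s : R) : s <= 0 -> Num.truncn s = 0%N.
    by move=> s0; apply/truncn0Pn; rewrite -ltNge (le_lt_trans s0).
  move: cf dlo dhi; rewrite (ltr0_norm tn0) ler_norml => /andP[h1 h2].
  rewrite !z; [|lra|lra]; rewrite /eta.
  have : expR (- (416 * C)) <= 1 by rewrite -[leRHS]expR0 ler_expR; lra.
  lra.
have tf : 0 <= t n - c * f n /\ t n <= 2 * (t n - c * f n) /\ t n + c * f n <= 2 * t n.
  by move: cf; rewrite (ger0_norm t0) ler_norml => /andP[h1 h2]; lra.
have S2 : 2 <= sum_tau r n.
  by apply: le_trans (sum_tau_ge r r0 n); rewrite lerMn2r/= ler1n.
(* From l d(l) <= 4 S and d > 1/2; the 1 comes from rounding. *)
have l1 : t n - c * f n <= 8 * sum_tau r n + 1.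
  have := dist_to_stat_lazy_walk_upper w n (pi n) w01 n0 st (Num.truncn (t n - c * f n)).
  rewrite -/r => h; have := truncnS_gt (t n - c * f n); rewrite -natr1.
  set L := (Num.truncn _)%:R in h *; have L0 : 0 <= L by [].
  move: dlo h; rewrite -/L; set D := dist_to_stat _ _ _ => dlo h.
  have : L / 2 <= 4 * sum_tau r n by apply: le_trans h; rewrite ler_wpM2l// ltW.
  lra.
pose L := Num.truncn (t n + c * f n).
(* L <= 4 (t_n - c f_n) <= 32 S + 4 <= 34 S because S >= 2, which leaves room below 52 C tau_k. *)
have L2 : L%:R <= 52 * C * tau r k.
  have : L%:R <= t n + c * f n 
    by rewrite truncn_le; move: cf; rewrite (ger0_norm t0) ler_norml => /andP[]; lra.
  move: SC S2 l1 tf; move: (sum_tau r n) => s; nra.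
have := @dist_to_stat_lazy_walk_lower R w n (pi n) w01 n0 st k m L erefl.
rewrite -/r => /(_ (lt_le_trans _ t4) mt); rewrite ltr_nat => /(_ isT).
apply/negP; rewrite -ltNge; apply: (lt_le_trans dhi); rewrite /eta ler_wpM2r//.
have y : 0 <= 2 / tau r k <= 2^-1.
  have tp : 0 < tau r k by exact: tau_gt0.
  by rewrite divr_ge0 ?(ltW tp)//= ler_pdivrMr//; lra.
apply: (@le_trans _ _ (expR (- (2 * (2 / tau r k))) ^+ (2 * L))); last first.
  by apply: lerXn2r; rewrite ?nnegrE ?expR_ge0 ?expR_le_1B//; lra.
rewrite -expRM_natl ler_expR mulrN lerN2 natrM.
have -> : 2%:R * L%:R * (2 * (2 / tau r k)) = 8 * (L%:R / tau r k).
  by field; rewrite lt0r_neq0// tau_gt0.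
have : L%:R / tau r k <= 52 * C by rewrite ler_pdivrMr// tau_gt0.
lra.
Qed.

(** * Independence and moments *)

Section Independence.
Context {d} {T : measurableType d} {R : realType} (P : probability T R).

(** The joint law is the product of the two laws, so Tonelli applies. Absolute values make the
    integrand nonnegative on the whole plane. *)
Lemma ge0_integral_mul_indep (X Y : T -> R) :
  measurable_fun setT X -> measurable_fun setT Y ->
  (forall x, 0 <= X x) -> (forall x, 0 <= Y x) ->
  (forall A B, measurable A -> measurable B ->
    P (X @^-1` A `&` Y @^-1` B) = (P (X @^-1` A) * P (Y @^-1` B))%E) ->
  (\int[P]_x (X x * Y x)%:E = (\int[P]_x (X x)%:E) * \int[P]_x (Y x)%:E)%E.
Proof.
move=> mX mY X0 Y0 ind.
pose X' : {mfun T >-> R} := HB.pack X (isMeasurableFun.Build _ _ _ _ _ mX).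
pose Y' : {mfun T >-> R} := HB.pack Y (isMeasurableFun.Build _ _ _ _ _ mY).
have mXY : measurable_fun setT (fun x => (X x, Y x)) by exact: measurable_fun_pair.
pose XY : {mfun T >-> (R * R)%type} :=
  HB.pack (fun x => (X x, Y x)) (isMeasurableFun.Build _ _ _ _ _ mXY).
pose m1 := distribution P X'; pose m2 := distribution P Y'.
have mabs : measurable_fun [set: R] (fun y : R => `|y|%:E).
  by apply/measurable_EFinP; exact: (@normr_measurable R setT).
pose f (z : R * R) : \bar R := (`|z.1| * `|z.2|)%:E.
have mf : measurable_fun setT f.
  apply/measurable_EFinP/measurable_funM.
    exact: (measurableT_comp (@normr_measurable R setT) measurable_fst).
  exact: (measurableT_comp (@normr_measurable R setT) measurable_snd).
have f0 z : (0 <= f z)%E by rewrite lee_fin mulr_ge0.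
have -> : (\int[P]_x (X x * Y x)%:E = \int[P]_x (f \o XY) x)%E.
  by apply: eq_integral => x _; rewrite /f /= !ger0_norm.
transitivity (\int[pushforward P XY]_z f z)%E.
  by rewrite ge0_integral_pushforward.
transitivity (\int[m1 \x m2]_z f z)%E.
  apply: eq_measure_integral => A mA _; apply/esym.
  apply: product_measure_unique => // B C mB mC.
rewrite fubini_tonelli1//.
have E2 : (\int[m2]_y `|y|%:E = \int[P]_x (Y x)%:E)%E.
  rewrite /m2 /distribution ge0_integral_pushforward//=.
  by apply: eq_integral => x _; rewrite /= ger0_norm.
have E1 : (\int[m1]_y `|y|%:E = \int[P]_x (X x)%:E)%E.
  rewrite /m1 /distribution ge0_integral_pushforward//=.
  by apply: eq_integral => x _; rewrite /= ger0_norm.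
transitivity (\int[m1]_x (`|x|%:E * \int[m2]_y `|y|%:E))%E.
  apply: eq_integral => x _; rewrite /fubini_F /f /=.
  under eq_integral do rewrite EFinM.
  by rewrite ge0_integralZl_EFin//.
rewrite ge0_integralZr//; first by rewrite E1 E2.
exact: integral_ge0.
Qed.

Variable X : nat -> T -> R.
Hypothesis mX : forall k, measurable_fun setT (X k).
Hypothesis indep : forall n (B : nat -> set R), (forall k, measurable (B k)) ->
  P (\bigcap_(k < n) X k @^-1` B k) = (\prod_(k < n) P (X k @^-1` B k))%E.

Definition cylinder (n : nat) : set (set T) :=
  [set A | exists2 B : nat -> set R, (forall k, measurable (B k)) &
    A = \bigcap_(k < n) X k @^-1` B k].

(* Adapted to the n-th sigma-algebra of the filtration generated by X, which
   is generated by X 0, ..., X n.-1. *)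
Definition adapted (n : nat) (Z : T -> R) :=
  @measurable_fun _ _ (g_sigma_algebraType (cylinder n)) R setT Z.

Lemma cylinder_setI n : setI_closed (cylinder n).
Proof.
move=> _ _ [B mB ->] [C mC ->]; exists (fun k => B k `&` C k).
  by move=> k; exact: measurableI.
apply/seteqP; split=> x; first by move=> [H1 H2] k kn; split; [exact: H1|exact: H2].
by move=> H; split=> k kn; case: (H k kn).
Qed.

Lemma preimage_measurable k B : measurable B -> measurable (X k @^-1` B).
Proof. by move=> mB; rewrite -[_ @^-1` _]setTI; exact: mX. Qed.

Lemma cylinder_measurable n : cylinder n `<=` measurable.
Proof.
move=> _ [B mB ->]; apply: bigcap_measurableType => // k _.
exact: preimage_measurable.
Qed.

Lemma g_cylinder_measurable n : <<s cylinder n >> `<=` measurable.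
Proof.
by apply: smallest_sub; [exact: sigma_algebra_measurable|exact: cylinder_measurable].
Qed.

Lemma adapted_measurable n Z : adapted n Z -> measurable_fun setT Z.
Proof.
by move=> aZ _ B mB; apply: (g_cylinder_measurable n); exact: aZ.
Qed.

(** Dynkin's pi-lambda theorem: the events that satisfy the product formula form a Dynkin system
    containing the cylinders, which are stable under intersection. *)
Lemma g_cylinder_indep n A B : <<s cylinder n >> A -> measurable B ->
  P (A `&` X n @^-1` B) = (P A * P (X n @^-1` B))%E.
Proof.
move=> sA mB; have mXB := preimage_measurable n _ mB.
pose D := [set A : set T | measurable A /\
  P (A `&` X n @^-1` B) = (P A * P (X n @^-1` B))%E].
suff : <<d cylinder n >> `<=` D.
  by rewrite setI_closed_g_dynkin_g_sigma_algebra; [move=> /(_ A sA)[]|exact: cylinder_setI].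
apply: smallest_sub; first split.
- by split => //; rewrite setTI probability_setT mul1e.
- move=> C [mC CE]; split; first exact: measurableC.
  have fin (E : set T) : measurable E -> P E \is a fin_num by move=> mE; exact: fin_num_measure.
  rewrite probability_setC// muleBl ?fin// ?mul1e ?fin//.
  rewrite -CE [~` C `&` _]setIC -setDE measureD//; last by rewrite ltey_eq fin.
  by rewrite [C `&` _]setIC.
- move=> F tF DF; split; first by apply: bigcup_measurable => k _; exact: (DF k).1.
  rewrite setI_bigcupl measure_semi_bigcup//; last 3 first.
  + by move=> k; apply: measurableI => //; exact: (DF k).1.
  + exact: trivIset_setIr.
  + by apply: bigcup_measurable => k _; apply: measurableI => //; exact: (DF k).1.
  rewrite measure_semi_bigcup//; last 2 first.
  + by move=> k; exact: (DF k).1.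
  + by apply: bigcup_measurable => k _; exact: (DF k).1.
  rewrite muleC -(fineK (fin_num_measure P _ mXB)) -nneseriesZl//.
  apply: eq_eseriesr => k _; rewrite fineK ?fin_num_measure// muleC; exact: (DF k).2.
move=> _ [C mC ->]; split.
  by apply: bigcap_measurableType => // k _; exact: preimage_measurable.
pose C' k := if k == n then B else C k.
have mC' k : measurable (C' k) by rewrite /C'; case: ifP.
have -> : \bigcap_(k < n) X k @^-1` C k `&` X n @^-1` B = \bigcap_(k < n.+1) X k @^-1` C' k.
  apply/seteqP; split => x.
    move=> [H Hn] k /=; rewrite ltnS leq_eqVlt /C' => /predU1P[->|kn]; first by rewrite eqxx.
    by rewrite ltn_eqF//; exact: H.
  move=> H; split; last by have := H n (ltnSn n); rewrite /C' eqxx.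
  by move=> k kn; have := H k (ltnW kn); rewrite /C' ltn_eqF.
rewrite !indep// big_ord_recr/= {2}/C' eqxx; congr (_ * _)%E.
by apply: eq_bigr => k _; rewrite /C' ltn_eqF.
Qed.

Lemma adapted_integral_mul n (Z : T -> R) (g : R -> R) :
  adapted n Z -> measurable_fun setT g -> (forall x, 0 <= Z x) ->
  (forall x, 0 <= g (X n x)) ->
  (\int[P]_x (Z x * g (X n x))%:E =
   (\int[P]_x (Z x)%:E) * \int[P]_x (g (X n x))%:E)%E.
Proof.
move=> aZ mg Z0 g0; apply: (ge0_integral_mul_indep Z (g \o X n)) => //.
- exact: adapted_measurable aZ.
- exact: measurableT_comp.
move=> A B mA mB; rewrite comp_preimage; apply: g_cylinder_indep.
  by rewrite -[_ @^-1` _]setTI; exact: aZ.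
by rewrite -[_ @^-1` _]setTI; exact: mg.
Qed.

Lemma adaptedS n Z : adapted n Z -> adapted n.+1 Z.
Proof.
suff sub : <<s cylinder n >> `<=` <<s cylinder n.+1 >>.
  by move=> aZ _ B mB; apply: sub; exact: aZ.
apply: smallest_sub; first exact: smallest_sigma_algebra.
move=> _ [B mB ->]; apply: sub_sigma_algebra.
exists (fun k => if k == n then setT else B k); first by move=> k; case: ifP.
apply/seteqP; split => x H k /=.
  by rewrite ltnS leq_eqVlt => /predU1P[->|kn]; rewrite ?eqxx// ltn_eqF//; exact: H.
by move=> kn; have := H k (ltnW kn); rewrite ltn_eqF.
Qed.

Lemma adapted_X n (g : R -> R) : measurable_fun setT g -> adapted n.+1 (g \o X n).
Proof.
move=> mg _ B mB; rewrite setTI; apply: sub_sigma_algebra.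
exists (fun k => if k == n then g @^-1` B else setT).
  by move=> k; case: ifP => // _; rewrite -[_ @^-1` _]setTI; exact: mg.
apply/seteqP; split => x H.
  by move=> k _ /=; case: ifP => // /eqP->.
by have := H n (ltnSn n); rewrite /= eqxx.
Qed.

End Independence.

Section AlmostSurelyBounded.
Context {d} {T : measurableType d} {R : realType} (P : probability T R).
Variables (g : nat -> nat -> T -> R) (C : R).
Hypotheses (mg : forall N K, measurable_fun setT (g N K))
  (g0 : forall N K x, 0 <= g N K x)
  (gnd : forall N x, nondecreasing_seq (fun K => g N K x))
  (gC : forall N K, (\int[P]_x (g N K x)%:E <= C%:E)%E).

Lemma limn_einf_ge_einfs (u : (\bar R)^nat) n : (einfs u n <= limn_einf u)%E.
Proof.
rewrite limn_einf_lim.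
have -> : limn (einfs u) = ereal_sup (range (einfs u)).
  by apply/cvg_lim => //; exact: cvg_einfs_sup.
by apply: ereal_sup_ubound; exists n.
Qed.

(* Fatou, applied first in K and then in N. *)
Lemma ae_frequently_bounded :
  {ae P, forall x, exists q : R, forall N0 : nat,
    exists2 N, (N0 <= N)%N & forall K, g N K x <= q}.
Proof.
have lim_le (u : (\bar R)^nat) : (forall n, u n <= C%:E)%E -> (limn_einf u <= C%:E)%E.
  move=> uC; rewrite limn_einf_lim; apply: lime_le; first exact: is_cvg_einfs.
  by apply: nearW => n; apply: ge_ereal_inf; exists (u n) => //; exists n => /=.
pose F N x := limn_einf (fun K => (g N K x)%:E).
have mlim (h : nat -> T -> \bar R) : (forall n, measurable_fun setT (h n)) ->
    measurable_fun setT (fun x => limn_einf (h ^~ x)).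
  move=> mh; apply: (emeasurable_fun_cvg (fun n x => einfs (h ^~ x) n)).
    by move=> n; exact: measurable_fun_einfs.
  by move=> x _; rewrite limn_einf_lim; exact: is_cvg_einfs.
have mF N : measurable_fun setT (F N).
  by apply: mlim => K; exact/measurable_EFinP.
have lim_ge0 (u : (\bar R)^nat) : (forall n, 0 <= u n)%E -> (0 <= limn_einf u)%E.
  move=> u0; apply: le_trans (limn_einf_ge_einfs _ 0%N).
  by apply: le_ereal_inf_tmp => _ [n _ <-].
have F0 N x : (0 <= F N x)%E by apply: lim_ge0 => n; rewrite lee_fin.
have FC N : (\int[P]_x F N x <= C%:E)%E.
  apply: le_trans (lim_le _ (gC N)); apply: fatou => // [K|K x _].
    exact/measurable_EFinP.
  by rewrite lee_fin.
have FF : (\int[P]_x limn_einf (F ^~ x) <= C%:E)%E.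
  exact: le_trans (fatou _ _ _ _) (lim_le _ FC).
have int : P.-integrable setT (fun x => limn_einf (F ^~ x)).
  apply/integrableP; split; first exact: mlim.
  rewrite (eq_integral (fun x => limn_einf (F ^~ x))).
    exact: le_lt_trans FF (ltry _).
  by move=> x _; rewrite gee0_abs//; exact: lim_ge0.
have := integrable_ae measurableT int; apply: filterS => x /(_ I).
set l := limn_einf _ => lfin; exists (fine l + 1) => N0.
(* The lower limit l is finite almost surely, so F N x < l + 1 for some N >= N0; monotonicity in K
   passes this bound to every [g N K x]. *)
have : (einfs (F ^~ x) N0 < (fine l + 1)%:E)%E.
  apply: le_lt_trans (limn_einf_ge_einfs _ _) _.
  by rewrite -/l -[l in (l < _)%E]fineK// lte_fin ltrDl.
move=> /ereal_inf_lt[_ [N /= N0N <-] Fq]; exists N => // K.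
rewrite -lee_fin; apply: le_trans (ltW Fq).
apply: le_trans (limn_einf_ge_einfs _ K).
apply: le_ereal_inf_tmp => _ [n /= Kn <-]; rewrite lee_fin; exact: gnd.
Qed.

End AlmostSurelyBounded.

(** * Power inequalities and moments of rho *)

(** Strict concavity at 1. With l = ln x, average 1 + u < exp u at u = (1 - k) l and u = - k l with
    weights k and 1 - k: the linear terms cancel. Then multiply by exp (k l). *)
Lemma powR_lt_tangent (R : realType) (k x : R) :
  0 < k < 1 -> 0 < x -> x != 1 -> x `^ k < k * x + (1 - k).
Proof.
move=> /andP[k0 k1] x0 x1; rewrite /powR gt_eqF//.
set l := ln x; have xE : x = expR l by rewrite lnK.
have l0 : l != 0 by apply: contra x1 => /eqP l0; rewrite xE l0 expR0.
have nz (c : R) : c != 0 -> c * l != 0 by move=> c0; rewrite mulf_neq0.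
have h1 : 1 + (1 - k) * l < expR ((1 - k) * l).
  by apply: expR_gt1Dx; apply: nz; rewrite lt0r_neq0// subr_gt0.
have h2 : 1 + - k * l < expR (- k * l).
  by apply: expR_gt1Dx; apply: nz; rewrite oppr_eq0 lt0r_neq0.
have e1 : x = expR (k * l) * expR ((1 - k) * l).
  by rewrite -expRD xE; congr expR; ring.
have e2 : 1 = expR (k * l) * expR (- k * l).
  by rewrite -expRD -[LHS]expR0; congr expR; ring.
have h3 : 1 < k * expR ((1 - k) * l) + (1 - k) * expR (- k * l) by nra.
have := expR_gt0 (k * l); move: e1 e2 h3.
move: (expR (k * l)) (expR ((1 - k) * l)) (expR (- k * l)) => a b c e1 e2 h3 a0.
have : a * 1 < a * (k * b + (1 - k) * c) by rewrite ltr_pM2l.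
rewrite mulr1 mulrDr [a * (k * b)]mulrCA -e1 [a * ((1 - k) * c)]mulrCA -e2.
by rewrite mulr1.
Qed.

Lemma measurable_inv (R : realType) : measurable_fun [set: R] (@GRing.inv R).
Proof.
(* At x = 0 both sides vanish by the convention 0^-1 = 0. *)
have -> : @GRing.inv R = fun x => x * (x ^+ 2) `^ (-1).
  apply/funext => x; rewrite powR_inv1 ?sqr_ge0// expr2.
  by have [->|x0] := eqVneq x 0; [rewrite invr0 !mul0r|field].
apply: measurable_funM; first exact: measurable_id.
by apply: (measurableT_comp (@measurable_powR R (-1))); exact: exprn_measurable.
Qed.

Lemma measurable_rho (R : realType) : measurable_fun [set: R] (@rho R).
Proof.
apply: measurable_funM; last exact: measurable_inv.
by apply: measurable_funB; [exact: measurable_cst|exact: measurable_id].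
Qed.

Lemma measurable_le_ind (R : realType) (c : R) :
  measurable_fun [set: R] (fun y : R => (y <= c)%R%:R : R).
Proof.
apply: nonincreasing_measurable => // x y xy.
by case: (leP y c) => [yc|_]; [rewrite (le_trans xy yc)|rewrite ler0n].
Qed.

(** Each a_i^s is at most q, so a_i = a_i^s (a_i^s)^(1/s - 1) <= a_i^s q^(1/s - 1). This passes from
    products of rho^s back to products of rho. *)
Lemma sum_le_powR (R : realType) (a : nat -> R) (s q : R) m :
  (forall i, 0 < a i) -> 0 < s <= 1 -> 0 <= q ->
  \sum_(i < m) a i `^ s <= q -> \sum_(i < m) a i <= q * q `^ (s^-1 - 1).
Proof.
move=> a0 /andP[s0 s1] q0 aq.
apply: (@le_trans _ _ (\sum_(i < m) a i `^ s * q `^ (s^-1 - 1))); last first.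
  by rewrite -mulr_suml ler_wpM2r// powR_ge0.
apply: ler_sum => i _.
have aiE : a i = a i `^ s * (a i `^ s) `^ (s^-1 - 1).
  rewrite -[in RHS](powRr1 (powR_ge0 (a i) s)) -!powRrM -powRD; last first.
    by rewrite (gt_eqF (a0 i)) implybT.
  rewrite -[LHS]powRr1 ?ltW//; congr (_ `^ _); field; exact: lt0r_neq0.
rewrite [leLHS]aiE ler_wpM2l ?powR_ge0//.
apply: ge0_ler_powR; rewrite ?nnegrE ?powR_ge0// ?subr_ge0 ?invf_ge1//.
apply: le_trans aq; rewrite (bigD1 i)//= lerDl.
by apply: sumr_ge0 => j _; exact: powR_ge0.
Qed.

Section FiniteExpectation.
Context {d} {T : measurableType d} {R : realType} (P : probability T R).

Lemma ge0_integral_eq0_ae (f : T -> R) : measurable_fun setT f ->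
  (forall x, 0 <= f x) -> (\int[P]_x (f x)%:E <= 0)%E ->
  {ae P, forall x, f x = 0}.
Proof.
move=> mf f0 If.
have : ae_eq P setT (EFin \o f) (cst 0%E).
  apply/ae_eq_integral_abs => //; first exact/measurable_EFinP.
  apply/eqP; rewrite eq_le; apply/andP; split; last exact: integral_ge0.
  rewrite (eq_integral (fun x => (f x)%:E))// => x _.
  by rewrite /= ger0_norm.
by apply: filterS => x /(_ I) [].
Qed.

Definition mean (Z : T -> R) : R := fine (\int[P]_x (Z x)%:E).

Lemma meanE (Z : T -> R) (C : R) : measurable_fun setT Z ->
  (forall x, 0 <= Z x <= C) ->
  (\int[P]_x (Z x)%:E = (mean Z)%:E)%E /\ 0 <= mean Z <= C.
Proof.
move=> mZ ZC.
have I0 : (0 <= \int[P]_x (Z x)%:E)%E.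
  by apply: integral_ge0 => x _; rewrite lee_fin; case/andP: (ZC x).
have I1 : (\int[P]_x (Z x)%:E <= C%:E)%E.
  rewrite -[leRHS]mule1 -(probability_setT P) -integral_cst//.
  apply: ge0_le_integral => //.
  - by move=> x _; rewrite lee_fin; case/andP: (ZC x).
  - exact/measurable_EFinP.
  - by move=> x _; rewrite lee_fin; case/andP: (ZC x).
have fin : (\int[P]_x (Z x)%:E)%E \is a fin_num.
  by rewrite ge0_fin_numE// (le_lt_trans I1)// ltry.
by rewrite /mean -!lee_fin !fineK// I0.
Qed.

End FiniteExpectation.

Section Moments.
Context d (T : measurableType d) (R : realType) (P : probability T R).
Variables (r : T -> R) (k : R).
Hypotheses (mr : measurable_fun setT r) (r0 : forall x, 0 < r x)
  (rk1 : (\int[P]_x (r x `^ k)%:E = 1)%E)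
  (rn1 : ~ {ae P, forall x, r x = 1}).

Let mpow s : measurable_fun setT (fun x => r x `^ s).
Proof. exact: (measurableT_comp (@measurable_powR R s)). Qed.

Let integral_probability_cst (c : R) : (\int[P]_x c%:E = c%:E)%E.
Proof. by rewrite -[RHS]mule1 -(probability_setT P) -integral_cst. Qed.

(** E (r^(k/2) - 1)^2 = 2 - 2 E r^(k/2), and the left side is positive unless r = 1 almost
    surely. *)
Lemma half_moment_lt1 : 0 < k -> (\int[P]_x (r x `^ (k / 2))%:E < 1)%E.
Proof.
move=> k0; set a := (X in (X < _)%E).
pose h x := (r x `^ (k / 2) - 1) ^+ 2.
have mh : measurable_fun setT h.
  by apply: measurable_funX; apply: measurable_funB => //; exact: measurable_cst.
have h0 x : 0 <= h x by exact: sqr_ge0.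
have a0 : (0 <= a)%E by apply: integral_ge0 => x _; rewrite lee_fin powR_ge0.
have E : (a + a + \int[P]_x (h x)%:E = 2%:E)%E.
  transitivity (\int[P]_x (r x `^ k + 1)%:E)%E; last first.
    under eq_integral do rewrite EFinD.
    rewrite ge0_integralD//; first by rewrite rk1 integral_probability_cst.
    - by move=> x _; rewrite lee_fin powR_ge0.
    - exact/measurable_EFinP.
  rewrite /a -ge0_integralD//; try exact/measurable_EFinP;
    try by move=> x _; rewrite lee_fin powR_ge0.
  rewrite -ge0_integralD//; try exact/measurable_EFinP.
  - apply: eq_integral => x _; rewrite -!EFinD /h; congr EFin.
    have -> : r x `^ k = (r x `^ (k / 2)) ^+ 2.
      by rewrite expr2 -powRD ?(gt_eqF (r0 x)) ?implybT//; congr (_ `^ _); field.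
    by ring.
  - by move=> x _; rewrite lee_fin addr_ge0// powR_ge0.
  - by apply/measurable_EFinP; exact: measurable_funD.
  - by move=> x _; rewrite lee_fin.
have hpos : (0 < \int[P]_x (h x)%:E)%E.
  rewrite ltNge; apply/negP => /(ge0_integral_eq0_ae P h mh h0).
  move=> ae0; apply: rn1; move: ae0; apply: filterS => x /eqP.
  rewrite sqrf_eq0 subr_eq0 => /eqP h1.
  have : (r x `^ (k / 2)) `^ (2 / k) = 1 by rewrite h1 powR1.
  rewrite -powRrM (_ : k / 2 * (2 / k) = 1) ?powRr1 ?ltW//.
  by field; exact: lt0r_neq0.
have fin : a \is a fin_num.
  rewrite ge0_fin_numE//; apply: (@le_lt_trans _ _ 2%:E); last exact: ltry.
  by rewrite -E -addeA leeDl// adde_ge0// ltW.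
move: E hpos; rewrite -(fineK fin).
case: (\int[P]_x _)%E => [b| |]//=; rewrite -!EFinD lte_fin => -[E] b0.
by rewrite lte_fin; lra.
Qed.

(** Otherwise monotone convergence gives E r <= 1. The gap h between tangent and power is then
    nonnegative with E h = k E r + (1 - k) - 1 <= 0, so h = 0 and r = 1 almost surely. *)
Lemma truncated_mean_gt1 : 0 < k < 1 ->
  exists2 M : R, 0 < M & 1 < mean P (fun x => Num.min (r x) M).
Proof.
move=> k01; have /andP[k0 k1] := k01; apply: contrapT => H.
have mm M : measurable_fun setT (fun x => Num.min (r x) M).
  by apply: measurable_minr => //; exact: measurable_cst.
have m0 n x : 0 <= Num.min (r x) n%:R by rewrite le_min ltW/=.
have le1 n : (\int[P]_x (Num.min (r x) n%:R)%:E <= 1)%E.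
  have [|E _] := meanE P (fun x => Num.min (r x) n%:R) n%:R (mm _).
    by move=> x; rewrite m0 ge_min lexx orbT.
  case: n E => [|n] E.
    rewrite (eq_integral (fun=> 0%E)) ?integral0//= => x _.
    by congr EFin; apply/min_idPr; exact: ltW.
  rewrite E lee_fin leNgt; apply/negP => m1; apply: H.
  by exists n.+1%:R.
have rle1 : (\int[P]_x (r x)%:E <= 1)%E.
  have cvgx x : (fun n => (Num.min (r x) n%:R)%:E) @ \oo --> (r x)%:E.
    apply: (cvg_near_cst _); exists (Num.truncn (r x)).+1 => // n /= hn.
    congr EFin; apply/min_idPl/(le_trans (ltW (truncnS_gt _))).
    by rewrite ler_nat.
  have -> : (\int[P]_x (r x)%:E = \int[P]_x limn (fun n => (Num.min (r x) n%:R)%:E))%E.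
    by apply: eq_integral => x _; apply/esym/cvg_lim.
  rewrite monotone_convergence//.
  - apply: lime_le; last by apply: nearW => n; exact: le1.
    apply: ereal_nondecreasing_is_cvgn => m n mn.
    apply: ge0_le_integral => //; try (by move=> x _; rewrite lee_fin);
      try exact/measurable_EFinP.
    by move=> x _; rewrite lee_fin le_min ge_min lexx/= ge_min ler_nat mn orbT.
  - by move=> n; exact/measurable_EFinP.
  - by move=> n x _; rewrite lee_fin.
  - move=> x _ m n mn; rewrite lee_fin le_min ge_min lexx/= ge_min ler_nat mn.
    by rewrite orbT.
pose h x := k * r x + (1 - k) - r x `^ k.
have h0 x : 0 <= h x.
  rewrite subr_ge0; have [->|x1] := eqVneq (r x) 1; first by rewrite powR1; lra.
  exact/ltW/powR_lt_tangent.
have mkr : measurable_fun setT (fun x => k * r x).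
  by apply: measurable_funM => //; exact: measurable_cst.
have mh : measurable_fun setT h.
  by apply: measurable_funB => //; apply: measurable_funD => //; exact: measurable_cst.
have E : (k%:E * \int[P]_x (r x)%:E + (1 - k)%:E = 1 + \int[P]_x (h x)%:E)%E.
  transitivity (\int[P]_x (k * r x + (1 - k))%:E)%E.
    under [RHS]eq_integral do rewrite EFinD EFinM.
    rewrite ge0_integralD//; try exact/measurable_EFinP.
    - rewrite (ge0_integralZl_EFin _ measurableT _ _ (ltW k0)).
      + by rewrite integral_probability_cst.
      + by move=> x _; rewrite lee_fin ltW.
      + exact/measurable_EFinP.
    - by move=> x _; rewrite lee_fin mulr_ge0// ltW.
    - by move=> x _; rewrite lee_fin subr_ge0 ltW.
  rewrite -[1%E]rk1 -ge0_integralD//; try exact/measurable_EFinP.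
  - by apply: eq_integral => x _; rewrite -EFinD /h; congr EFin; ring.
  - by move=> x _; rewrite lee_fin powR_ge0.
  - by move=> x _; rewrite lee_fin.
apply: rn1; have : (\int[P]_x (h x)%:E <= 0)%E.
  have : (1 + \int[P]_x (h x)%:E <= 1)%E.
    rewrite -E; apply: (@le_trans _ _ (k%:E * 1 + (1 - k)%:E)%E).
      by rewrite leeD2r// lee_wpmul2l// lee_fin ltW.
    by rewrite mule1 -EFinD addrC subrK.
  by rewrite -{2}[1%E]adde0 leeD2lE.
move=> /(ge0_integral_eq0_ae P h mh h0); apply: filterS => x hx.
apply/eqP/negPn/negP => rx1; have := powR_lt_tangent _ k (r x) k01 (r0 x) rx1.
by rewrite -subr_gt0 -/(h x) hx ltxx.
Qed.

End Moments.

Section FactorizedProducts.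
Context d (T : measurableType d) (R : realType) (P : probability T R)
  (omega : int -> {RV P >-> R}).

Lemma mutually_independent_nat n (B : nat -> set R) :
  mutually_independent omega -> (forall k, measurable (B k)) ->
  P (\bigcap_(k < n) omega k.+1%:Z @^-1` B k) =
  (\prod_(k < n) P (omega k.+1%:Z @^-1` B k))%E.
Proof.
move=> ind mB.
pose s := [seq k.+1%:Z | k <- iota 0 n].
(* Undoes the shift from k to the site k+1. *)
pose A (z : int) := B `|z|%N.-1.
have := ind [fset z in s]%fset A (fun z => mB _).
have -> : \bigcap_(j in [set` [fset z in s]%fset]) (omega j @^-1` A j) =
    \bigcap_(k < n) omega k.+1%:Z @^-1` B k.
  apply/seteqP; split => x H.
    move=> k /= kn; apply: (H k.+1%:Z); rewrite /= inE.
    by apply/mapP; exists k => //; rewrite mem_iota.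
  move=> z /=; rewrite inE => /mapP[k]; rewrite mem_iota /= => kn ->.
  exact: H.
move=> ->; rewrite (perm_big s)/=; last first.
  apply: uniq_perm; [exact: fset_uniq| |by move=> z; rewrite inE].
  by rewrite /s map_inj_uniq ?iota_uniq// => a b [].
rewrite big_map -[RHS](big_mkord xpredT (fun k => P (omega k.+1%:Z @^-1` B k))).
by rewrite /index_iota subn0.
Qed.

Lemma identically_distributed_integral i j (g : R -> R) :
  identically_distributed omega -> measurable_fun setT g ->
  (forall x, 0 <= g (omega i x)) -> (forall x, 0 <= g (omega j x)) ->
  (\int[P]_x (g (omega i x))%:E = \int[P]_x (g (omega j x))%:E)%E.
Proof.
move=> id mg gi gj.
have push l : (forall x, 0 <= g (omega l x)) ->
  (\int[P]_x (g (omega l x))%:E = \int[distribution P (omega l)]_y `|g y|%:E)%E.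
  move=> gl; rewrite /distribution ge0_integral_pushforward//=.
    by apply: eq_integral => x _; rewrite /= ger0_norm.
  by apply/measurable_EFinP; apply: measurableT_comp => //; exact: normr_measurable.
rewrite !push//; apply: eq_measure_integral => A mA _; exact: id.
Qed.

End FactorizedProducts.

(** * Exit times of the crossing share *)

Section MeanTheory.
Context {d} {T : measurableType d} {R : realType} (P : probability T R).

Definition bounded_rv (C : R) (Z : T -> R) :=
  measurable_fun setT Z /\ forall x, 0 <= Z x <= C.

Lemma mean_ge0 C Z : bounded_rv C Z -> 0 <= mean P Z.
Proof. by case=> mZ ZC; have [_ /andP[]] := meanE P Z C mZ ZC. Qed.

Lemma mean_leC C Z : bounded_rv C Z -> mean P Z <= C.
Proof. by case=> mZ ZC; have [_ /andP[]] := meanE P Z C mZ ZC. Qed.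

Lemma integral_mean C Z : bounded_rv C Z -> (\int[P]_x (Z x)%:E = (mean P Z)%:E)%E.
Proof. by case=> mZ ZC; have [] := meanE P Z C mZ ZC. Qed.

Lemma ler_mean C Z W : bounded_rv C Z -> bounded_rv C W ->
  (forall x, Z x <= W x) -> mean P Z <= mean P W.
Proof.
move=> bZ bW ZW; rewrite -lee_fin -(integral_mean _ _ bZ) -(integral_mean _ _ bW).
case: bZ bW => mZ Z0 [mW W0]; apply: ge0_le_integral => //.
- by move=> x _; rewrite lee_fin; case/andP: (Z0 x).
- exact/measurable_EFinP.
- exact/measurable_EFinP.
- by move=> x _; rewrite lee_fin.
Qed.

Lemma bounded_rvD C1 C2 Z W : bounded_rv C1 Z -> bounded_rv C2 W ->
  bounded_rv (C1 + C2) (fun x => Z x + W x).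
Proof.
move=> [mZ Z0] [mW W0]; split; first exact: measurable_funD.
by move=> x; have := Z0 x; have := W0 x; lra.
Qed.

Lemma bounded_rvM C1 C2 Z W : bounded_rv C1 Z -> bounded_rv C2 W ->
  bounded_rv (C1 * C2) (fun x => Z x * W x).
Proof.
move=> [mZ Z0] [mW W0]; split; first exact: measurable_funM.
move=> x; have /andP[z0 z1] := Z0 x; have /andP[w0 w1] := W0 x.
by rewrite mulr_ge0//= ler_pM.
Qed.

Lemma bounded_rv_cst (c : R) : 0 <= c -> bounded_rv c (fun=> c).
Proof. by split; [exact: measurable_cst|move=> _; rewrite lexx andbT]. Qed.

Lemma meanD C1 C2 Z W : bounded_rv C1 Z -> bounded_rv C2 W ->
  mean P (fun x => Z x + W x) = mean P Z + mean P W.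
Proof.
move=> bZ bW; apply: EFin_inj; rewrite -(integral_mean _ _ (bounded_rvD _ _ _ _ bZ bW)) EFinD.
rewrite -(integral_mean _ _ bZ) -(integral_mean _ _ bW).
case: bZ bW => mZ Z0 [mW W0].
under eq_integral do rewrite EFinD.
rewrite ge0_integralD//; try exact/measurable_EFinP.
- by move=> x _; rewrite lee_fin; case/andP: (Z0 x).
- by move=> x _; rewrite lee_fin; case/andP: (W0 x).
Qed.

Lemma meanZ C Z (c : R) : 0 <= c -> bounded_rv C Z ->
  mean P (fun x => c * Z x) = c * mean P Z.
Proof.
move=> c0 bZ; have b2 := bounded_rvM _ _ _ _ (bounded_rv_cst c c0) bZ.
apply: EFin_inj; rewrite -(integral_mean _ _ b2) EFinM -(integral_mean _ _ bZ).
case: bZ => mZ Z0; under eq_integral do rewrite EFinM.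
rewrite ge0_integralZl_EFin//; last exact/measurable_EFinP.
by move=> x _; rewrite lee_fin; case/andP: (Z0 x).
Qed.

Lemma bounded_rv_sum C (Z : nat -> T -> R) n : (forall i, bounded_rv C (Z i)) ->
  bounded_rv (C *+ n) (fun x => \sum_(i < n) Z i x) /\
  mean P (fun x => \sum_(i < n) Z i x) = \sum_(i < n) mean P (Z i).
Proof.
move=> bZ; elim: n => [|n [IH1 IH2]].
  split.
    by under eq_fun do rewrite big_ord0; exact: bounded_rv_cst.
  under eq_fun do rewrite big_ord0; rewrite big_ord0.
  apply/le_anti/andP; split; first exact: mean_leC (bounded_rv_cst 0 (lexx _)).
  exact: mean_ge0 (bounded_rv_cst 0 (lexx _)).
rewrite [in RHS]big_ord_recr/= -IH2 mulrSr.
under eq_fun do rewrite big_ord_recr/=.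
by split; [exact: bounded_rvD|exact: meanD IH1 (bZ n)].
Qed.

End MeanTheory.

(** The share of the last edge in the expected time to go from 0 to k+1; this is the u_k of the
    overview. *)
Definition crossing_share {R : realType} (r : nat -> R) (k : nat) : R :=
  tau r k / sum_tau r k.+1.

Section CrossingShare.
Context {R : realType} (r : nat -> R).
Hypothesis r0 : forall k, 0 < r k.

Lemma sum_tau_gt0 k : 0 < sum_tau r k.+1.
Proof.
apply: lt_le_trans (sum_tau_ge r r0 k.+1).
by rewrite pmulrn_lgt0// ltr0n.
Qed.

Lemma crossing_share_bounds k : 0 < crossing_share r k <= 1.
Proof.
have S0 := sum_tau_gt0 k.
rewrite /crossing_share divr_gt0 ?tau_gt0//= ler_pdivrMr// mul1r sum_tauS lerDr.
by apply: sumr_ge0 => j _; exact/ltW/tau_gt0.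
Qed.

(** u_(k+1) is increasing in tau_(k+1) >= g tau_k, whence u_(k+1) >= g u_k / (1 + g u_k), with g u_k
    <= M eps. *)
Lemma crossing_share_drift k (g M eps : R) :
  0 <= g <= M -> g <= r k.+1 -> crossing_share r k <= eps ->
  crossing_share r k * g <= (1 + M * eps) * crossing_share r k.+1.
Proof.
move=> /andP[g0 gM] gr ueps.
have S0 := sum_tau_gt0 k; have S1 := sum_tau_gt0 k.+1.
have t0 := tau_gt0 r r0 k.
have /andP[u0 u1] := crossing_share_bounds k.
have tE : tau r k = crossing_share r k * sum_tau r k.+1.
  by rewrite /crossing_share divfK// lt0r_neq0.
rewrite [crossing_share r k.+1]/crossing_share mulrA ler_pdivlMr// (sum_tauS r k.+1).
have : g * tau r k <= tau r k.+1.
  by rewrite /=; have := r0 k.+1; nra.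
move: (crossing_share r k) (sum_tau r k.+1) (tau r k.+1) tE S0 u0 ueps u1.
move=> u S t -> S0 u0 ueps u1 gt.
have gM' : u * g <= M * eps by rewrite mulrC ler_pM// ltW.
have ug0 : 0 <= u * g by rewrite mulr_ge0// ltW.
have t0' : 0 <= t by apply: le_trans gt; rewrite !mulr_ge0// ltW.
have : u * g * t <= M * eps * t by rewrite ler_wpM2r.
nra.
Qed.

(** S_k = (1 - u_k) S_(k+1) gives S_(k+1) <= S_k exp (2 u_k) when u_k <= 1/2; summable shares would
    bound S, contrary to S_n >= 2 n. *)
Lemma crossing_share_not_summable N (q : R) :
  (forall j, crossing_share r (N + j) <= 2^-1) ->
  (forall n, \sum_(j < n) crossing_share r (N + j) <= q) -> False.
Proof.
move=> h hq.
have st j : sum_tau r (N + j).+1 <= sum_tau r (N + j) * expR (2 * crossing_share r (N + j)).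
  set u := crossing_share r _.
  have S0 := sum_tau_gt0 (N + j).
  have uS : sum_tau r (N + j).+1 * (1 - u) = sum_tau r (N + j).
    rewrite mulrBr mulr1 /u /crossing_share mulrC divfK ?lt0r_neq0//.
    by rewrite sum_tauS addrK.
  have u0 : 0 <= u <= 2^-1 by rewrite h andbT ltW//; case/andP: (crossing_share_bounds (N + j)).
  rewrite -uS -mulrA; apply: ler_peMr; first exact: ltW.
  have := expR_le_1B _ _ u0; rewrite expRN.
  by rewrite -[(expR _)^-1]mul1r ler_pdivrMr ?expR_gt0.
have bd n : sum_tau r (N + n) <= sum_tau r N * expR (2 * \sum_(j < n) crossing_share r (N + j)).
  elim: n => [|n IH]; first by rewrite big_ord0 mulr0 expR0 mulr1 addn0.
  rewrite addnS big_ord_recr/= mulrDr expRD mulrA.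
  by apply: (le_trans (st n)); rewrite ler_wpM2r// expR_ge0.
have SN0 : 0 <= sum_tau r N by apply: sumr_ge0 => j _; exact/ltW/tau_gt0.
pose B := sum_tau r N * expR (2 * q).
have Bge n : n%:R *+ 2 <= B.
  apply: le_trans (le_trans (bd n) _).
    apply: le_trans (sum_tau_ge r r0 (N + n)).
    by rewrite lerMn2r/= ler_nat leq_addl.
  by rewrite ler_wpM2l// ler_expR ler_wpM2l.
have := Bge (Num.truncn B).+1; have := truncnS_gt B.
have : 0 <= (Num.truncn B).+1%:R :> R by []. lra.
Qed.

End CrossingShare.

Lemma ratio_prod_powR (R : realType) (r : nat -> R) (s : R) k i :
  (forall j, 0 < r j) ->
  ratio_prod r k i `^ s = ratio_prod (fun j => r j `^ s) k i.
Proof.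
move=> r0; elim: i => [|i IH]; first by rewrite /ratio_prod !big_ord0 powR1.
by rewrite !ratio_prodS powRM ?ltW ?ratio_prod_gt0// IH.
Qed.

(** * Exits in the random environment and the products that follow them *)

Section Environment.
Context {d} {T : measurableType d} {R : realType} (P : probability T R)
  (omega : int -> {RV P >-> R}).
Hypotheses (omega01 : forall (k : int) (x : T), 0 < omega k x < 1)
  (indep : mutually_independent omega)
  (ident : identically_distributed omega).

Local Notation X := (fun (k : nat) (x : T) => omega k.+1%:Z x).
Local Notation r := (fun (x : T) (k : nat) => rho (omega k%:Z x)).
Local Notation r_ s := (fun (x : T) (k : nat) => rho (omega k%:Z x) `^ s).
Local Notation adapted := (adapted X).

Let r0 x k : 0 < r x k. Proof. exact: (rho_gt0 (fun z => omega z x)). Qed.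
Local Hint Extern 0 (is_true (0 < rho _)) => exact: r0 : core.

Let mX k : measurable_fun setT (X k). Proof. by []. Qed.

Let indepX n (B : nat -> set R) : (forall k, measurable (B k)) ->
  P (\bigcap_(k < n) X k @^-1` B k) = (\prod_(k < n) P (X k @^-1` B k))%E.
Proof. exact: mutually_independent_nat. Qed.

Let adaptedD n Z W : adapted n Z -> adapted n W -> adapted n (fun x => Z x + W x).
Proof. exact: measurable_funD. Qed.

Let adaptedM n Z W : adapted n Z -> adapted n W -> adapted n (fun x => Z x * W x).
Proof. exact: measurable_funM. Qed.

Let adapted_comp n Z (g : R -> R) : measurable_fun setT g -> adapted n Z ->
  adapted n (fun x => g (Z x)).
Proof. by move=> mg aZ; exact: (measurableT_comp mg aZ). Qed.

Let adapted_cst n c : adapted n (fun=> c).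
Proof. exact: measurable_cst. Qed.

Let adapted_ext n Z W : adapted n W -> Z =1 W -> adapted n Z.
Proof. by move=> aW /funext->. Qed.

Let adapted_r k : adapted k.+1 (r ^~ k.+1).
Proof. exact: (adapted_X X k _ (@measurable_rho R)). Qed.

(** tau_k involves the sites 1, ..., k only, that is [X 0], ..., [X k.-1], and so is independent of
    rho at the site k+1. *)
Let adapted_tau k : adapted k (fun x => tau (r x) k).
Proof.
elim: k => [|k IH]; first exact: adapted_cst.
apply: adaptedD; first by apply: adaptedM => //; apply: adaptedD.
by apply: adaptedM => //; exact: adaptedS.
Qed.

Let adapted_sum_tau k : adapted k (fun x => sum_tau (r x) k.+1).
Proof.
elim: k => [|k IH].
  apply: (adapted_ext _ _ (fun=> 2)) => // x.
  by rewrite /sum_tau big_ord1.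
apply: (adapted_ext _ _ (fun x => sum_tau (r x) k.+1 + tau (r x) k.+1)).
  by apply: adaptedD => //; exact: adaptedS.
by move=> x; rewrite sum_tauS.
Qed.

Let adapted_share k : adapted k (fun x => crossing_share (r x) k).
Proof.
apply: adaptedM => //; apply: adapted_comp => //; exact: measurable_inv.
Qed.

Variables (eps s : R).

(** Indicator that no exit occurs at N, ..., N+i-1. *)
Let stay N i x : R := \prod_(j < i) (crossing_share (r x) (N + j) <= eps)%R%:R.

Let stayS N i x :
  stay N i.+1 x = stay N i x * (crossing_share (r x) (N + i) <= eps)%R%:R.
Proof. exact: big_ord_recr. Qed.

Let stay_bool N i x : (stay N i x == 0) || (stay N i x == 1).
Proof.
elim: i => [|i IH]; first by rewrite /stay big_ord0 eqxx orbT.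
rewrite stayS; case: (_ <= eps)%R; first by rewrite mulr1.
by rewrite mulr0 eqxx.
Qed.

Let adapted_stay N i : adapted (N + i) (stay N i) /\ adapted (N + i) (stay N i.+1).
Proof.
have step j : adapted (N + j) (stay N j) -> adapted (N + j) (stay N j.+1).
  move=> aj; apply: (adapted_ext _ _ _ _ (stayS N j)).
  apply: adaptedM => //; apply: (adapted_comp _ _ _ (measurable_le_ind _ eps)).
  exact: adapted_share.
suff a : adapted (N + i) (stay N i) by split => //; exact: step.
elim: i => [|i IH]; last by rewrite addnS; apply: adaptedS; exact: step.
by apply: (adapted_ext _ _ (fun=> 1)) => // x; rewrite /stay big_ord0.
Qed.

Let stay01 N i x : 0 <= stay N i x <= 1.
Proof. by case/orP: (stay_bool N i x) => /eqP->; rewrite ?lexx ler01. Qed.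

Let stay_le N i x : stay N i.+1 x <= stay N i x.
Proof.
rewrite stayS; have /andP[h _] := stay01 N i x.
by case: (_ <= eps)%R; rewrite ?mulr1 ?mulr0.
Qed.

Let stay1P N i x : stay N i.+1 x != 0 -> crossing_share (r x) (N + i) <= eps.
Proof. by rewrite stayS; case: (leP _ eps); rewrite ?mulr0 ?eqxx. Qed.

Let am n Z : adapted n Z -> measurable_fun setT Z.
Proof. exact: (adapted_measurable X mX). Qed.

Let bstay N i : bounded_rv 1 (stay N i).
Proof. by split; [exact: am (adapted_stay N i).1|exact: stay01]. Qed.

Let bshare k : bounded_rv 1 (fun x => crossing_share (r x) k).
Proof.
split=> [|x]; first exact: am (adapted_share k).
by have /andP[/ltW-> ->] := crossing_share_bounds (r x) (r0 x) k.
Qed.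

Let kept N i j x := crossing_share (r x) (N + i) * stay N j x.

Let bkept N i j : bounded_rv 1 (kept N i j).
Proof. by rewrite -(mulr1 1); exact: bounded_rvM. Qed.

Variables (M delta : R).
Hypotheses (M0 : 0 < M) (delta0 : 0 < delta) (eps0 : 0 < eps) (eps1 : eps <= 2^-1)
  (drift : (1 + delta) * (1 + M * eps) <= mean P (fun x => Num.min (rho (omega 0 x)) M)).

(** Integrate [crossing_share_drift] over the event of staying: truncated rho at N+i+1 is
    independent of [kept N i i.+1], and [drift] absorbs the factor 1 + M eps. *)
Let kept_drift N i : (1 + delta) * mean P (kept N i i.+1) <= mean P (kept N i.+1 i.+1).
Proof.
pose g (w : R) := Num.max 0 (Num.min (rho w) M).
have mg : measurable_fun setT g.
  apply: measurable_maxr; first exact: measurable_cst.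
  by apply: measurable_minr; [exact: measurable_rho|exact: measurable_cst].
have gE k x : g (omega k x) = Num.min (rho (omega k x)) M.
  by rewrite /g; apply/max_idPr; rewrite le_min !ltW// (rho_gt0 (fun z => omega z x)).
have g0 k x : 0 <= g (omega k x) by rewrite /g le_max lexx.
have gM k x : 0 <= g (omega k x) <= M by rewrite g0 gE ge_min lexx orbT.
have akept : adapted (N + i) (kept N i i.+1).
  by apply: adaptedM; [exact: adapted_share|exact: (adapted_stay N i).2].
have bg k : bounded_rv M (fun x => g (omega k x)).
  by split; [exact: measurableT_comp|exact: gM].
have bk := bkept N i i.+1; have bk' := bkept N i.+1 i.+1.
have prodE : mean P (fun x => kept N i i.+1 x * g (X (N + i)%N x)) =
    mean P (kept N i i.+1) * mean P (fun x => g (omega 0 x)).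
  apply: EFin_inj; rewrite EFinM -(integral_mean P _ _ bk) -(integral_mean P _ _ (bg 0)).
  rewrite -(integral_mean P _ _ (bounded_rvM _ _ _ _ bk (bg _))).
  rewrite (adapted_integral_mul P X mX indepX (N + i) _ g)//; last first.
    by move=> x; case: bk => _ /(_ x)/andP[].
  congr (_ * _)%E; apply: (identically_distributed_integral _ _ _ P omega) => //.
have gdrift : (1 + delta) * (1 + M * eps) <= mean P (fun x => g (omega 0 x)).
  by apply: (le_trans drift); rewrite (funext (gE 0)).
have Me : 0 < 1 + M * eps by rewrite ltr_wpDr// mulr_ge0// ltW.
rewrite -(ler_pM2l Me) -(meanZ P _ _ _ (ltW Me) bk').
apply: le_trans (_ : mean P (kept N i i.+1) * mean P (fun x => g (omega 0 x)) <= _).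
  have := mean_ge0 P _ _ bk; move: gdrift; move: (mean P _) (mean P _) => a b; nra.
rewrite -prodE.
have b1 := bounded_rvM _ _ _ _ bk (bg (N + i).+1%:Z).
have b2 := bounded_rvM _ _ _ _ (bounded_rv_cst _ (ltW Me)) bk'.
rewrite !mul1r !mulr1 in b1 b2.
have mono C1 C2 Z : C1 <= C2 -> bounded_rv C1 Z -> bounded_rv C2 Z.
  by move=> C12 [mZ Z0]; split => // x; have /andP[-> /le_trans->] := Z0 x.
apply: (@ler_mean _ _ _ P (M + (1 + M * eps))).
- by apply: mono b1; rewrite lerDl ltW.
- by apply: mono b2; rewrite lerDr ltW.
move=> x; rewrite /kept.
case/orP: (stay_bool N i.+1 x) => /eqP sE; rewrite sE ?(mulr0, mul0r)//.
rewrite !mulr1 addnS; apply: (crossing_share_drift (r x) (r0 x) (N + i) (g (X (N + i)%N x))).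
- exact: gM.
- by rewrite gE ge_min lexx.
- by apply: stay1P; rewrite sE oner_neq0.
Qed.

(** As shares are at most 1, removing the paths that exit at N+i+1 costs at most their
    probability. *)
Let kept_step N i : mean P (kept N i.+1 i.+1) + mean P (stay N i.+2) <=
  mean P (kept N i.+1 i.+2) + mean P (stay N i.+1).
Proof.
rewrite -!(meanD P 1 1)//.
apply: (@ler_mean _ _ _ P (1 + 1)); try exact: bounded_rvD.
move=> x; rewrite /kept; have := stay_le N i.+1 x.
have /andP[_ u1] := crossing_share_bounds (r x) (r0 x) (N + i.+1).
nra.
Qed.

(** Adding [kept_drift] and [kept_step] telescopes, and the boundary terms lie between 0 and 1. *)
Let kept_sum N n : delta * \sum_(i < n) mean P (kept N i i.+1) <= 2.
Proof.
suff H : mean P (kept N 0 1) + mean P (stay N n.+1) +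
    delta * \sum_(i < n) mean P (kept N i i.+1) <=
    mean P (kept N n n.+1) + mean P (stay N 1).
  have := mean_ge0 P _ _ (bkept N 0 1); have := mean_ge0 P _ _ (bstay N n.+1).
  have := mean_leC P _ _ (bkept N n n.+1); have := mean_leC P _ _ (bstay N 1).
  lra.
elim: n => [|n IH]; first by rewrite big_ord0 mulr0 addr0.
rewrite big_ord_recr/=; have := kept_drift N n; have := kept_step N n.
lra.
Qed.

Lemma ae_exit : {ae P, forall x, forall N, exists i, crossing_share (r x) (N + i) > eps}.
Proof.
apply: ae_foralln => N.
(* Constant in its first argument: only almost sure boundedness in K is sought. Without an exit, g
   is the sum of all shares after N. *)
pose g (_ : nat) K x := \sum_(i < K) kept N i i.+1 x.
have gb K := bounded_rv_sum P 1 (fun i => kept N i i.+1) K (fun i => bkept N i i.+1).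
have mg N' K : measurable_fun setT (g N' K) by case: (gb K) => -[].
have g0 N' K x : 0 <= g N' K x by case: (gb K) => -[_ /(_ x)/andP[]].
have gnd N' x : nondecreasing_seq (fun K => g N' K x).
  apply/nondecreasing_seqP => K; rewrite /g big_ord_recr/= lerDl.
  by case: (bkept N K K.+1) => _ /(_ x)/andP[].
have gC N' K : (\int[P]_x (g N' K x)%:E <= (2 / delta)%:E)%E.
  rewrite (integral_mean P _ _ (gb K).1) lee_fin (gb K).2.
  by rewrite ler_pdivlMr// mulrC kept_sum.
have := ae_frequently_bounded P g (2 / delta) mg g0 gnd gC.
apply: filterS => x [q Hq].
apply: contrapT => /forallNP H.
have le j : crossing_share (r x) (N + j) <= eps by rewrite leNgt; apply/negP; exact: H.
apply: (crossing_share_not_summable (r x) (r0 x) N q).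
  by move=> j; exact: le_trans (le j) eps1.
move=> n; have [N' _ HN'] := Hq 0%N; apply: le_trans (HN' n).
apply: ler_sum => i _; rewrite /kept.
have -> : stay N i.+1 x = 1 by apply: big1 => j _; rewrite le.
by rewrite mulr1.
Qed.

(* Indicator of crossing_share > eps for the first time after N at N + i. *)
Let exit_at N i x : R := stay N i x - stay N i.+1 x.

Let adapted_exit N i : adapted (N + i) (exit_at N i).
Proof.
apply: adaptedD; first exact: (adapted_stay N i).1.
by apply: (measurableT_comp (@oppr_measurable R setT)); exact: (adapted_stay N i).2.
Qed.

Let exit_ge0 N i x : 0 <= exit_at N i x.
Proof. by rewrite subr_ge0. Qed.

Let bexit N i : bounded_rv 1 (exit_at N i).
Proof.
split=> [|x]; first exact: am (adapted_exit N i).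
rewrite exit_ge0/= /exit_at; have := stay01 N i x; have := stay01 N i.+1 x; lra.
Qed.

Let sum_exit N n : \sum_(i < n) mean P (exit_at N i) <= 1.
Proof.
suff -> : \sum_(i < n) mean P (exit_at N i) = mean P (stay N 0) - mean P (stay N n).
  have := mean_leC P _ _ (bstay N 0); have := mean_ge0 P _ _ (bstay N n); lra.
elim: n => [|n IH]; first by rewrite big_ord0 subrr.
rewrite big_ord_recr/= IH.
have : mean P (stay N n) = mean P (exit_at N n) + mean P (stay N n.+1).
  by rewrite -(meanD P 1 1)//; congr mean; apply/funext => x; rewrite /exit_at subrK.
lra.
Qed.

Let exit_first N x : (exists i, crossing_share (r x) (N + i) > eps) ->
  exists i, exit_at N i x = 1 /\ crossing_share (r x) (N + i) > eps.
Proof.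
move=> ex; have := ex_minnP ex => -[i Hi min]; exists i; split => //.
have s1 : stay N i x = 1.
  apply: big1 => j _; case: leP => // /min; by rewrite leqNgt ltn_ord.
by rewrite /exit_at stayS s1 leNgt Hi mulr0 subr0.
Qed.

Variables (a : R).
Hypotheses (s0 : 0 < s <= 1) (a01 : 0 <= a < 1)
  (moment : (\int[P]_x (rho (omega 0 x) `^ s)%:E = a%:E)%E).

Let after N i j x := exit_at N i x * ratio_prod (r_ s x) (N + i) j.

Let after_ge0 N i j x : 0 <= after N i j x.
Proof. by rewrite mulr_ge0// prodr_ge0// => k _; exact: powR_ge0. Qed.

Let adapted_after N i j : adapted (N + i + j) (after N i j).
Proof.
elim: j => [|j IH].
  rewrite addn0; apply: (adapted_ext _ _ (exit_at N i)) => // x.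
  by rewrite /after /ratio_prod big_ord0 mulr1.
rewrite addnS.
apply: (adapted_ext _ _ (fun x => after N i j x * r x (N + i + j).+1 `^ s)); last first.
  by move=> x; rewrite /after ratio_prodS mulrA.
apply: adaptedM; first exact: adaptedS.
apply: (adapted_comp _ _ _ (@measurable_powR R s)); exact: adapted_r.
Qed.

(** The exit at N+i is decided by the sites up to N+i, so each later factor rho^s is independent of
    the past and contributes a. *)
Let integral_after N i j :
  (\int[P]_x (after N i j x)%:E = (mean P (exit_at N i) * a ^+ j)%:E)%E.
Proof.
elim: j => [|j IH].
  rewrite expr0 mulr1 -(integral_mean P _ _ (bexit N i)).
  by apply: eq_integral => x _; rewrite /after /ratio_prod big_ord0 mulr1.
under eq_integral do rewrite /after ratio_prodS mulrA -/(after N i j _).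
pose g (w : R) := rho w `^ s.
have mg : measurable_fun setT g.
  by apply: (measurableT_comp (@measurable_powR R s)); exact: measurable_rho.
rewrite (adapted_integral_mul P X mX indepX (N + i + j) (after N i j) g)//; last first.
  by move=> x; exact: powR_ge0.
rewrite IH exprSr mulrA [RHS]EFinM -moment; congr (_ * _)%E.
by apply: (identically_distributed_integral _ _ _ P omega) => // x; exact: powR_ge0.
Qed.

(** For fixed N the mean of the sum of the [after] terms is at most 1 / (1 - a), since the exit
    probabilities sum to at most 1. A bound valid for infinitely many N then applies at the first
    exit after such an N. *)
Lemma ae_frequent_exit : {ae P, forall x, exists q : R, forall N0, exists k,
  [/\ (N0 <= k)%N, eps * sum_tau (r x) k.+1 <= tau (r x) k &
      forall m, \sum_(i < m) ratio_prod (r x) k i.+1 <= q]}.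
Proof.
pose g N K x := \sum_(i < K) \sum_(j < K) after N i j.+1 x.
have mafter N i j : measurable_fun setT (after N i j) by exact: am (adapted_after N i j).
have mg N K : measurable_fun setT (g N K).
  by apply: measurable_sum => i; apply: measurable_sum.
have g0 N K x : 0 <= g N K x by apply: sumr_ge0 => i _; apply: sumr_ge0.
have gnd N x : nondecreasing_seq (fun K => g N K x).
  apply/nondecreasing_seqP => K; rewrite /g big_ord_recr/= ler_wpDr ?sumr_ge0//.
  by apply: ler_sum => i _; rewrite big_ord_recr/= lerDl.
have gC N K : (\int[P]_x (g N K x)%:E <= ((1 - a)^-1)%:E)%E.
  rewrite /g; under eq_integral do rewrite -sumEFin.
  rewrite ge0_integral_sum//; last 2 first.
  - by move=> i; apply/measurable_EFinP/measurable_sum.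
  - by move=> i x _; rewrite lee_fin sumr_ge0.
  have E i : (\int[P]_x (\sum_(j < K) after N i j.+1 x)%:E =
      (mean P (exit_at N i) * \sum_(j < K) a ^+ j.+1)%:E)%E.
    under eq_integral do rewrite -sumEFin.
    rewrite ge0_integral_sum//; last 2 first.
    - by move=> j; apply/measurable_EFinP.
    - by move=> j x _; rewrite lee_fin.
    by rewrite mulr_sumr -sumEFin; apply: eq_bigr => j _; exact: integral_after.
  under eq_bigr do rewrite E.
  rewrite sumEFin lee_fin -mulr_suml.
  have [a0 a1] := andP a01.
  have geo : (1 - a) * \sum_(j < K) a ^+ j.+1 + a ^+ K.+1 = a.
    elim: K {E} => [|K IH]; first by rewrite big_ord0 mulr0 add0r expr1.
    by rewrite big_ord_recr/= -[RHS]IH [a ^+ K.+2]exprS; ring.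
  have aK : 0 <= a ^+ K.+1 by exact: exprn_ge0.
  rewrite -[leRHS]mul1r; apply: ler_pM => //; last 1 first.
  - by rewrite -[leRHS]mul1r ler_pdivlMr ?subr_gt0// mulrC; lra.
  - by apply: sumr_ge0 => i _; exact: mean_ge0 (bexit N i).
  - by apply: sumr_ge0 => j _; exact: exprn_ge0.
have := ae_frequently_bounded P g _ mg g0 gnd gC.
have := ae_exit; apply: filterS2 => x ex [q Hq].
exists (q * q `^ (s^-1 - 1)) => N0; have [N N0N HN] := Hq N0.
have [i [ei ui]] := exit_first _ _ (ex N).
exists (N + i)%N; split; first exact: leq_trans (leq_addr _ _).
  by rewrite -ler_pdivlMr ?(sum_tau_gt0 (r x) (r0 x))// ltW.
move=> m; apply: (sum_le_powR _ (fun j => ratio_prod (r x) (N + i) j.+1)) => //.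
- by move=> j; exact: (ratio_prod_gt0 (r x) (r0 x)).
- exact: le_trans (HN 0%N).
(* This K exceeds the exit index i and is at least m; the remaining terms are nonnegative. *)
apply: le_trans (HN (m + i.+1)%N).
rewrite /g (bigD1 (Ordinal (leq_addl m i.+1)))//= ler_wpDr//.
  by apply: sumr_ge0 => *; apply: sumr_ge0.
rewrite big_split_ord/= ler_wpDr ?sumr_ge0//.
apply: ler_sum => j _; rewrite /after ei mul1r.
by rewrite ratio_prod_powR.
Qed.

End Environment.

(** * Choice of the constants and conclusion *)

Theorem theorem1p5 (d : measure_display) (T : measurableType d) (R : realType)
    (P : probability T R) (omega : int -> {RV P >-> R}) (kappa : R)
    (omega01 : forall (k : int) (x : T), 0 < omega k x < 1)
    (indep : mutually_independent omega)
    (ident : identically_distributed omega)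
    (Elnrho : ('E_P[(fun x => ln (rho (omega 0 x)))%R] < 0)%E)
    (kappaP : unique (fun s : R =>
       [/\ 0 < s,
           ('E_P[(fun x => rho (omega 0 x) `^ s)%R] = 1)%E &
           ('E_P[(fun x => rho (omega 0 x) `^ s * lnp (rho (omega 0 x)))%R]
              < +oo)%E]) kappa)
    (nonlat : nonlattice P (fun x => ln (rho (omega 0 x))))
    (kappa_lt1 : kappa < 1) :
  {ae P, forall x : T,
    forall pi : forall n : nat, 'I_n.+1 -> R,
      (forall n : nat, (0 < n)%N ->
         stationary (@lazy_walk R (fun k => omega k x) n) (pi n)) ->
      ~ exists t f : nat -> R,
          exhibits_cutoff (@lazy_walk R (fun k => omega k x)) pi t f}.
Proof.
have [[kappa0 Erho _] _] := kappaP.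
have rho0 x : 0 < rho (omega 0 x) by exact: (rho_gt0 (fun z => omega z x)).
have mrho : measurable_fun setT (fun x => rho (omega 0 x)).
  by apply: (measurableT_comp (@measurable_rho R)).
(* Otherwise E ln rho would be 0. *)
have rho_neq1 : ~ {ae P, forall x, rho (omega 0 x) = 1}.
  move=> rho1; move: Elnrho; rewrite unlock.
  suff -> : (\int[P]_x (ln (rho (omega 0 x)))%:E = 0)%E by rewrite ltxx.
  rewrite (@ae_eq_integral _ _ _ P setT (cst 0%E) _) ?integral0//.
    by apply/measurable_EFinP; exact: (measurableT_comp (@measurable_ln R)).
  by apply: filterS rho1 => x -> _ /=; rewrite ln1.
rewrite unlock in Erho.
have [M M0 m1] : exists2 M : R, 0 < M &
    1 < mean P (fun x => Num.min (rho (omega 0 x)) M).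
  apply: (truncated_mean_gt1 _ _ _ P _ kappa mrho rho0 Erho rho_neq1).
  by rewrite kappa0.
have half := half_moment_lt1 _ _ _ _ _ _ mrho rho0 Erho rho_neq1 kappa0.
set m := mean P _ in m1.
(* Makes 1 + M eps at most (m + 1) / 2 < m, so that the growth rate [delta] below is positive. *)
pose eps := Num.min 2^-1 ((m - 1) / (2 * M)).
have eps0 : 0 < eps by rewrite lt_min invr_gt0 ltr0n divr_gt0 ?mulr_gt0// subr_gt0.
have Meps : M * eps <= (m - 1) / 2.
  have -> : (m - 1) / 2 = M * ((m - 1) / (2 * M)) by field; exact: lt0r_neq0.
  by rewrite ler_pM2l// ge_min lexx orbT.
have Me0 : 0 < M * eps by rewrite mulr_gt0.
pose delta := m / (1 + M * eps) - 1.
have Me1 : 0 < 1 + M * eps by lra.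
have delta0 : 0 < delta by rewrite subr_gt0 ltr_pdivlMr//; lra.
have drift : (1 + delta) * (1 + M * eps) <= m.
  by rewrite /delta addrC subrK divfK// lt0r_neq0.
have half0 : (0 <= \int[P]_x (rho (omega 0 x) `^ (kappa / 2))%:E)%E.
  by apply: integral_ge0 => x _; rewrite lee_fin powR_ge0.
have half_fin : (\int[P]_x (rho (omega 0 x) `^ (kappa / 2))%:E)%E \is a fin_num.
  by rewrite ge0_fin_numE// (lt_trans half)// ltry.
have eps1 : eps <= 2^-1 by rewrite ge_min lexx.
have s01 : 0 < kappa / 2 <= 1 by apply/andP; split; lra.
have a01 : 0 <= fine (\int[P]_x (rho (omega 0 x) `^ (kappa / 2))%:E)%E < 1.
  by rewrite -lee_fin -lte_fin fineK// half0 half.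
have := ae_frequent_exit P omega omega01 indep ident eps (kappa / 2) M delta M0
  delta0 eps0 eps1 drift _ s01 a01 (esym (fineK half_fin)).
apply: filterS => x [q Hq] pi stat.
apply: (no_cutoff _ _ eps (Num.max q 1) (fun z => omega01 z x) eps0 _ _ pi stat).
  by rewrite lt_max ltr01 orbT.
move=> N; have [k [Nk ek qk]] := Hq N; exists k; split=> // m'.
by apply: (le_trans (qk m')); rewrite le_max lexx.
Qed.
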